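(* Let $M$ be the Hardy–Littlewood maximal operator on $\mathbb{R}^n$, let $k$ be a positive integer, and let $1<p<\infty$. There is a constant $c$, independent of $w$, such that for every $w\in A_p$ $$\|M^k\|_{L^p(w)}\le c\,[w]_{A_p}^{\frac{k}{p-1}},$$ and the exponent is sharp: the exponent $\frac{k}{p-1}$ cannot be replaced by any smaller number in an estimate valid for all $w\in A_p$ with a constant independent of $w$.
   Context: $Mf(x)=\sup_{Q\ni x}\frac1{|Q|}\int_Q|f(y)|\,dy$, the supremum being over all cubes containing $x$ with sides parallel to the coordinate axes, and $M^k=M(M^{k-1})$ is the $k$-fold iterate ($M^1=M$). A weight is a non-negative locally integrable function $w$ on $\mathbb{R}^n$. For $1<p<\infty$, $p'$ is defined by $1/p+1/p'=1$, and $w\in A_p$ means $$[w]_{A_p}:=\sup_{Q}\left(\frac1{|Q|}\int_Q w\right)\left(\frac1{|Q|}\int_Q w^{1-p'}\right)^{p-1}<\infty,$$ the supremum being over all cubes $Q\subset\mathbb{R}^n$. $\|f\|_{L^p(w)}=(\int|f|^p w\,dx)^{1/p}$, and $\|T\|_{L^p(w)}$ denotes the smallest constant $C$ such that $\|Tf\|_{L^p(w)}\le C\|f\|_{L^p(w)}$ for all $f\in L^p(w)$. *)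

(* Defs.v *)
From HB Require Import structures.
From mathcomp Require Import all_boot all_order all_algebra.
From mathcomp Require Import all_classical all_reals all_analysis.
From mathcomp Require Import measurable_realfun.

Set Implicit Arguments.
Unset Strict Implicit.
Unset Printing Implicit Defensive.

Import Order.TTheory GRing.Theory Num.Theory.
Import numFieldNormedType.Exports.

Local Open Scope classical_set_scope.
Local Open Scope ring_scope.

Section tuple_cons_measure.
Context (R : realType) (n : nat).
Local Notation T := (measurableTypeR R).

Definition tcons (x : T * n.-tuple T) : n.+1.-tuple T := [tuple of x.1 :: x.2].

Lemma measurable_tcons : measurable_fun [set: T * n.-tuple T] tcons.
Proof. exact: measurable_cons. Qed.

Variable m : {sigma_finite_measure set (n.-tuple T) -> \bar R}.

(* [R^(n+1)] carries the image of the product measure on [R * R^n]. *)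
Definition tcons_measure : set (n.+1.-tuple T) -> \bar R :=
  pushforward (@lebesgue_measure R \x m)%E tcons.

Let tcons_measure0 : tcons_measure set0 = 0%E.
Proof. by rewrite /tcons_measure /pushforward preimage_set0 measure0. Qed.

Let tcons_measure_ge0 A : (0 <= tcons_measure A)%E.
Proof. by rewrite /tcons_measure /pushforward measure_ge0. Qed.

Let tcons_measure_sigma_additive : semi_sigma_additive tcons_measure.
Proof.
move=> F mF tF mUF; rewrite /tcons_measure /pushforward preimage_bigcup.
apply: measure_semi_sigma_additive.
- by move=> i; rewrite -[X in measurable X]setTI; exact: measurable_tcons.
- apply/trivIsetP => /= i j _ _ ij; rewrite -preimage_setI.
  by move/trivIsetP : tF => /(_ _ _ _ _ ij) ->//; rewrite preimage_set0.
- rewrite -preimage_bigcup -[X in measurable X]setTI.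
  exact: measurable_tcons.
Qed.

HB.instance Definition _ := isMeasure.Build _ _ _ tcons_measure
  tcons_measure0 tcons_measure_ge0 tcons_measure_sigma_additive.

Let tcons_measure_sigma_finite : sigma_finite setT tcons_measure.
Proof.
have /sigma_finiteP[F [FT ndF Foo]] := sigma_finiteT (@lebesgue_measure R).
have /sigma_finiteP[G [GT ndG Goo]] := sigma_finiteT m.
pose uncons (t : n.+1.-tuple T) : T * n.-tuple T :=
  (thead t, [tuple of behead t]).
have unconsK : cancel tcons uncons.
  by move=> [x t]; congr pair; apply/val_inj.
have munc : measurable_fun setT uncons.
  apply/measurable_fun_pairP; split.
    exact: (measurable_tnth (T := T) (@ord0 n)).
  exact: measurable_behead.
exists (fun k => uncons @^-1` (F k `*` G k)).
  rewrite -preimage_bigcup [X in _ @^-1` X](_ : _ = setT) ?preimage_setT//.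
  apply/seteqP; split=> // -[x t] _.
  have [i _ Fix] : (\bigcup_k F k) x by rewrite -FT.
  have [j _ Gjt] : (\bigcup_k G k) t by rewrite -GT.
  exists (maxn i j) => //; split => /=.
  - by move: x Fix; exact/subsetPset/ndF/leq_maxl.
  - by move: t Gjt; exact/subsetPset/ndG/leq_maxr.
move=> k; have [mF Fk] := Foo k; have [mG Gk] := Goo k; split.
  by rewrite -[X in measurable X]setTI; apply: munc => //; exact: measurableX.
rewrite /tcons_measure /pushforward -comp_preimage.
rewrite (_ : uncons \o tcons = id); last by apply/funext => x /=; rewrite unconsK.
by rewrite product_measure1E// lte_mul_pinfty// ge0_fin_numE.
Qed.

HB.instance Definition _ := Measure_isSigmaFinite.Build _ _ _ tcons_measure
  tcons_measure_sigma_finite.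

End tuple_cons_measure.

Fixpoint borel_lebesgue (R : realType) (n : nat) :
    {sigma_finite_measure set (n.-tuple (measurableTypeR R)) -> \bar R} :=
  match n with
  | 0 => \d_([tuple] : 0.-tuple (measurableTypeR R))
  | n'.+1 => tcons_measure (borel_lebesgue R n')
  end.

Lemma borel_lebesgue_box (R : realType) (n : nat)
    (A : 'I_n -> set (measurableTypeR R)) :
  (forall i, measurable (A i)) ->
  borel_lebesgue R n [set t | forall i, A i (tnth t i)] =
  (\prod_(i < n) lebesgue_measure (A i))%E.
Proof.
elim: n A => [|n IHn] A mA /=.
  by rewrite diracE big_ord0 mem_set// => -[].
rewrite big_ord_recl /tcons_measure /pushforward.
rewrite -(IHn (fun i => A (lift ord0 i)))// -product_measure1E//; last first.
  rewrite [X in measurable X](_ : _ = \bigcap_(i in [set: 'I_n])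
      ((fun t : n.-tuple _ => tnth t i) @^-1` A (lift ord0 i))).
    apply: fin_bigcap_measurable => // i _.
    by rewrite -[X in measurable X]setTI; exact: measurable_tnth.
  by apply/seteqP; split=> [t At i _|t At i] /=; [exact: At|exact: At].
congr ((_ \x _)%E _); apply/seteqP; split=> -[x t] /= => [At|[A0 At] i].
  split; first exact: (At ord0).
  by move=> i; have := At (lift ord0 i); rewrite tnthS.
by case: (unliftP ord0 i) => [j ->|->]; [rewrite tnthS; exact: At|].
Qed.

(* [euclid R n] is R^n with the sigma-algebra of Lebesgue measurable sets: a
   copy of [n.-tuple R] carrying the completion of [borel_lebesgue R n]. *)
Definition euclid (R : realType) (n : nat) : Type :=
  caratheodory_type ((borel_lebesgue R n)^*)%mu.

HB.instance Definition _ (R : realType) (n : nat) :=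
  Measurable.on (euclid R n).

Definition lebesgue (R : realType) (n : nat) : set (euclid R n) -> \bar R :=
  @completed_measure_extension _ _ _ (borel_lebesgue R n).

HB.instance Definition _ (R : realType) (n : nat) :=
  Measure.on (@lebesgue R n).

Lemma lebesgue_sigma_finite (R : realType) (n : nat) :
  sigma_finite setT (@lebesgue R n).
Proof. exact/completed_measure_extension_sigma_finite/sigma_finiteT. Qed.

HB.instance Definition _ (R : realType) (n : nat) :=
  Measure_isSigmaFinite.Build _ _ _ (@lebesgue R n)
    (@lebesgue_sigma_finite R n).

Section weights.
Context (R : realType) (n : nat).
Local Notation mu := (@lebesgue R n).
Local Open Scope ereal_scope.
Implicit Types (f g : euclid R n -> \bar R) (w : euclid R n -> R).
Implicit Types (Q : set (euclid R n)) (x : euclid R n) (p : R).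

Definition cube (a : n.-tuple R) (l : R) : set (euclid R n) :=
  [set x : n.-tuple R |
    forall i, (tnth a i <= tnth x i)%R /\ (tnth x i <= tnth a i + l)%R].

Definition is_cube Q : Prop := exists a l, (0 < l)%R /\ Q = cube a l.

Definition average Q g : \bar R := (fine (mu Q))^-1%:E * \int[mu]_(y in Q) g y.

Definition maximal f x : \bar R :=
  ereal_sup [set average Q (fun y => `|f y|) | Q in [set Q | is_cube Q /\ Q x]].

(* Cubes are compact and every compact set lies in a cube, so integrability on
   cubes is local integrability. *)
Definition weight w : Prop :=
  [/\ forall x, (0 <= w x)%R, measurable_fun [set: euclid R n] w &
      forall Q, is_cube Q -> \int[mu]_(x in Q) (w x)%:E < +oo].

Definition conj_exp p : R := (1 - p^-1)^-1%R.

(* The power [u `^ s] of the nonnegative real [u] with the convention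
   [0 `^ s = +oo] for [s < 0]; the library's real power gives 0 there, under
   which the characteristic function of a cube would be an A_p weight. *)
Definition weight_pow (u s : R) : \bar R :=
  if (u == 0%R) && (s < 0)%R then +oo else (u `^ s)%:E.

Definition Ap_const p w : \bar R :=
  ereal_sup [set average Q (fun x => (w x)%:E) *
      average Q (fun x => weight_pow (w x) (1 - conj_exp p)) `^ (p - 1)
    | Q in is_cube].

Definition Ap p w : Prop := weight w /\ Ap_const p w < +oo.

Definition wnorm p w f : \bar R :=
  (\int[mu]_x (`|f x| `^ p * (w x)%:E)) `^ p^-1.

Definition in_Lp p w f : Prop :=
  measurable_fun [set: euclid R n] f /\ wnorm p w f < +oo.

(* The infimum is attained as soon as some constant is admissible, and is +oo
   otherwise; [0 <= C] only matters when [w] vanishes almost everywhere. *)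
Definition opnorm p w (T : (euclid R n -> \bar R) -> euclid R n -> \bar R) :
    \bar R :=
  ereal_inf [set C%:E | C in [set C : R | (0 <= C)%R /\
    forall f, in_Lp p w f -> wnorm p w (T f) <= C%:E * wnorm p w f]].

End weights.

Lemma lebesgue_cube (R : realType) (n : nat) (a : n.-tuple R) (l : R) :
  0 <= l -> lebesgue (cube a l) = (l ^+ n)%:E.
Proof.
move=> l0.
pose A i : set (measurableTypeR R) := [set` `[tnth a i, tnth a i + l]].
have -> : cube a l = [set t : n.-tuple _ | forall i, A i (tnth t i)].
  apply/seteqP; split=> [t At i|t At i]; rewrite /A /=.
    by rewrite in_itv /=; apply/andP; exact: At.
  by have := At i; rewrite /A /= in_itv /= => /andP.
have mA i : measurable (A i) by exact: measurable_itv.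
have mB : measurable [set t : n.-tuple (measurableTypeR R) |
    forall i, A i (tnth t i)].
  rewrite [X in measurable X](_ : _ = \bigcap_(i in [set: 'I_n])
      ((fun t : n.-tuple _ => tnth t i) @^-1` A i)).
    apply: fin_bigcap_measurable => // i _.
    by rewrite -[X in measurable X]setTI; exact: measurable_tnth.
  by apply/seteqP; split=> [t At i _|t At i] /=; exact: At.
rewrite /lebesgue /completed_measure_extension /= measurable_mu_extE//.
rewrite [LHS](borel_lebesgue_box mA) (eq_bigr (fun=> l%:E)) => [|i _].
  by rewrite prodEFin big_const_ord iter_mulr_1.
rewrite lebesgue_measure_itv /= lte_fin ltrDl.
case: ltP => [_|l'0]; first by rewrite -EFinB addrC addKr.
by have -> : l = 0 by apply/le_anti; rewrite l0 l'0.
Qed.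

(* Main.v *)
Require Import Defs.
From HB Require Import structures.
From mathcomp Require Import all_boot all_order all_algebra.
From mathcomp Require Import all_classical all_reals all_analysis.
From mathcomp Require Import measurable_realfun ring lra.

Set Implicit Arguments.
Unset Strict Implicit.
Unset Printing Implicit Defensive.

Import Order.TTheory GRing.Theory Num.Theory.

Local Open Scope classical_set_scope.
Local Open Scope ring_scope.

(* Upper bound (after Lerner).  For a dyadic cube Q, with sigma = w^(1-p'), the
   A_p condition gives
     (|f|_Q)^(p-1) <= [w]_{A_p} |Q| / w(Q) (1/sigma(Q) \int_Q |f|)^(p-1),
   so that the dyadic maximal function satisfies
     (M f)^(p-1) <= [w]_{A_p} M_w ((M_sigma (f / sigma))^(p-1) / w),
   where the weighted dyadic maximal operators M_w and M_sigma are bounded on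
   L^p'(w) and L^p(sigma) by Doob's inequality, uniformly in the weights.  Every
   cube lies in a comparable cube of one of 2^n shifted dyadic grids, which
   yields the exponent 1/(p-1) for M, hence k/(p-1) for M^k.

   Sharpness.  Take w(x) = |x_0|^((p-1)(1-d)) and f(x) = x_0^(d-1) on the unit
   cube, with d -> 0: then [w]_{A_p} <= (4/d)^(p-1), while M f >= f/(2d), hence
   M^k f >= (2d)^(-k) f. *)

(** * Doob's inequality for a finite family of nested sets *)

(** The averaging inequality is the only place where [[w]_{A_p}] is lost: raised to the power [p']
    it costs [A^p'], and the final [p]-th root turns this into [A^(1/(p-1))]. Doob's constants
    depend on the exponents alone. Doob's inequality is obtained without stopping times, by
    induction on a finite list of sets. It ends by absorbing half of [\int M^p u], which is
    legitimate only when this integral is finite. Hence every estimate is made for finitely many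
    cells, and monotone convergence gives the full dyadic maximal function. The passage between [w]
    and its dual weight divides by both, so the core argument takes [w] positive everywhere and [f]
    finite everywhere. General data are reduced to this by changes on null sets, after showing that
    an [A_p] weight is either zero almost everywhere or positive almost everywhere. In the sharpness
    part a competing exponent may be negative. Handling it needs a lower bound 1 for the A_p
    constants of the examples, which is deduced from the upper bound of the theorem. *)

Section power_inequalities.
Variable R : realType.
Implicit Types p a c g m : R.

(** Young's inequality for [c^(p-1) a] with exponents [p' = p/(p-1)] and [p]. In the induction for
    Doob's inequality, [c] is the old and [a] the new value of the maximal function on an added
    set. *)
Lemma powR_subr_le p a c : 1 < p -> 0 <= a -> 0 <= c ->
  a `^ p - c `^ p <= p / (p - 1) * a * (a `^ (p - 1) - c `^ (p - 1)).
Proof.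
move=> p1 a0 c0; have p0 : 0 < p by lra.
have q0 : 0 < p / (p - 1) by apply: divr_gt0; lra.
have pn0 : p != 0 by rewrite gt_eqF.
have p1n0 : p - 1 != 0 by rewrite gt_eqF// subr_gt0.
have := @conjugate_powR R (c `^ (p - 1)) a (p / (p - 1)) p (powR_ge0 _ _) a0 q0 p0.
rewrite -powRrM (_ : (p - 1) * (p / (p - 1)) = p); last by field.
move=> /(_ _)/wrap[]; first by field; rewrite pn0 p1n0.
rewrite -(mulr_powRB1 a0 p0).
set A := a `^ (p - 1); set B := c `^ (p - 1); set C := c `^ p => h.
have h2 : p / (p - 1) * (B * a) <= p / (p - 1) * (C / (p / (p - 1)) + a * A / p).
  by rewrite ler_pM2l.
have e : p / (p - 1) * (C / (p / (p - 1)) + a * A / p) = C + a * A / (p - 1).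
  by field; rewrite pn0 p1n0.
have e2 : p / (p - 1) * a * (A - B) =
  a * A + a * A / (p - 1) - p / (p - 1) * (B * a) by field.
by rewrite e2; rewrite e in h2; lra.
Qed.

(** Split at [m = 2 p' g]: above it the left side is at most half of [m^p], below it [m^(p-1)] is at
    most [(2 p' g)^(p-1)]. *)
Lemma young_absorb p g m : 1 < p -> 0 <= g -> 0 <= m ->
  p / (p - 1) * g * m `^ (p - 1) <= 2^-1 * m `^ p +
    p / (p - 1) * (2 * (p / (p - 1))) `^ (p - 1) * g `^ p.
Proof.
move=> p1 g0 m0; have p0 : 0 < p by lra.
have q0 : 0 < p / (p - 1) by apply: divr_gt0; lra.
set q := p / (p - 1) in q0 *.
have [mg|gm] := leP m (2 * q * g).
  apply: ler_wpDl; first by rewrite mulr_ge0// powR_ge0.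
  rewrite -(mulr_powRB1 g0 p0).
  rewrite [leRHS](_ : _ = q * g * ((2 * q) `^ (p - 1) * g `^ (p - 1))); last by ring.
  have q2 : 0 <= 2 * q by rewrite mulr_ge0// ltW.
  have q2g : 0 <= 2 * q * g by rewrite mulr_ge0.
  apply: ler_wpM2l; first by rewrite mulr_ge0// ltW.
  rewrite -(powRM _ q2 g0); apply: ge0_ler_powR; rewrite ?nnegrE//.
  by rewrite subr_ge0 ltW.
apply: ler_wpDr; first by rewrite mulr_ge0 ?powR_ge0// mulr_ge0 ?powR_ge0// ltW.
rewrite -(mulr_powRB1 m0 p0) mulrA ler_wpM2r ?powR_ge0//. lra.
Qed.

(** For [1 < p] this is [(2 p')^p], that is, [2^p] times the sharp constant of Doob's inequality.
    The outer factor 2 undoes the 1/2 of [young_absorb]. *)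
Definition doob_cst p : R :=
  2 * (p / (p - 1) * (2 * (p / (p - 1))) `^ (p - 1)).

Lemma doob_cst_ge0 p : 1 < p -> 0 <= doob_cst p.
Proof.
by move=> p1; rewrite !mulr_ge0 ?powR_ge0// ?invr_ge0 ?subr_ge0 ltW// (lt_trans _ p1).
Qed.

End power_inequalities.

Lemma measurable_fun_powRl d (T : measurableType d) (R : realType) (f : T -> R) p :
  measurable_fun setT f -> measurable_fun setT (fun x => f x `^ p).
Proof. exact: (@measurableT_comp _ _ _ _ _ _ (@powR R ^~ p)). Qed.

Lemma measurable_fun_abse d (T : measurableType d) (R : realType) (D : set T)
  (f : T -> \bar R) :
  measurable_fun setT f -> measurable_fun D (fun x => `|f x|)%E.
Proof. by move=> mf; apply/measurable_funTS; exact: measurableT_comp. Qed.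

Section doob.
Local Open Scope ereal_scope.
Context d (T : measurableType d) (R : realType).
Variable mu : {measure set T -> \bar R}.
Context (I : eqType) (Q : I -> set T).
Implicit Types (a : I -> R) (s : seq I).

Definition max_over a s x : R := (\big[Num.max/0]_(i <- s) (a i * \1_(Q i) x))%R.

Lemma max_over_cons a i s x :
  max_over a (i :: s) x = Num.max (a i * \1_(Q i) x)%R (max_over a s x).
Proof. by rewrite /max_over big_cons. Qed.

Lemma max_over_ge0 a s x : (0 <= max_over a s x)%R.
Proof.
elim: s => [|i s IH]; first by rewrite /max_over big_nil.
by rewrite max_over_cons le_max IH orbT.
Qed.

Lemma le_max_over a s i x : i \in s -> Q i x -> (a i <= max_over a s x)%R.
Proof.
elim: s => // j s IH; rewrite inE max_over_cons le_max => /predU1P[->|/IH h] Qx.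
  by rewrite indicE mem_set// mulr1 lexx.
by rewrite h ?orbT.
Qed.

Lemma max_over_sub a s s' x : {subset s <= s'} -> (forall i, (0 <= a i)%R) ->
  (max_over a s x <= max_over a s' x)%R.
Proof.
move=> + a0; elim: s => [|i s IH] ss; first by rewrite {1}/max_over big_nil max_over_ge0.
rewrite max_over_cons ge_max; apply/andP; split; last first.
  by apply: IH => j js; apply: ss; rewrite inE js orbT.
rewrite indicE; have [/set_mem Qx|_] := boolP (x \in Q i).
  by rewrite mulr1 le_max_over// ss// mem_head.
by rewrite mulr0 max_over_ge0.
Qed.

Lemma measurable_max_over a s : (forall i, measurable (Q i)) ->
  measurable_fun setT (max_over a s).
Proof.
move=> mQ; elim: s => [|i s IH].
  by rewrite (_ : max_over a [::] = cst 0%R)//; apply/funext => x; rewrite /max_over big_nil.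
rewrite (_ : max_over a (i :: s) =
  (fun x => Num.max (a i * \1_(Q i) x)%R (max_over a s x))); last first.
  by apply/funext => x; rewrite max_over_cons.
apply: measurable_maxr => //; apply: measurable_funM => //.
Qed.

(** The list runs from small sets to large ones, so recursion on it adds the smallest set last. *)
Fixpoint refining s : Prop := if s is i :: s' then
  (forall j, j \in s' -> Q i `<=` Q j \/ Q i `&` Q j = set0) /\ refining s'
  else True.

(** Every later set contains all of [Q i] or misses it, so each indicator in the maximum is constant
    on [Q i]. *)
Lemma max_over_cst a i s : refining (i :: s) ->
  exists c, (0 <= c)%R /\ forall x, Q i x -> max_over a s x = c.
Proof.
move=> [h _]; have [->|/set0P[y Qy]] := eqVneq (Q i) set0; first by exists 0%R.
exists (max_over a s y); split => [|x Qx]; first exact: max_over_ge0.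
rewrite /max_over !big_seq; apply: eq_bigr => j /h[sub|dis].
  by rewrite !indicE !mem_set//; exact: sub.
rewrite !indicE !memNset// => Qj.
  by have : (Q i `&` Q j) y by []; rewrite dis.
by have : (Q i `&` Q j) x by []; rewrite dis.
Qed.

Variables (p : R) (u g : T -> R) (a : I -> R).
Hypothesis p1 : (1 < p)%R.
Hypothesis mQ : forall i, measurable (Q i).
Hypotheses (u0 : forall x, (0 <= u x)%R) (mu_ : measurable_fun setT u).
Hypotheses (g0 : forall x, (0 <= g x)%R) (mg : measurable_fun setT g).
Hypothesis a0 : forall i, (0 <= a i)%R.

Let q := (p / (p - 1))%R.
Let M s x := max_over a s x.
Let P s x := (M s x `^ p * u x)%R.
Let D s x := (q * g x * M s x `^ (p - 1) * u x - P s x)%R.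

Let step i s : refining (i :: s) -> exists al be : R,
  [/\ (be <= al * a i)%R, (0 <= al)%R, (0 <= be)%R,
   forall x, P (i :: s) x = (P s x + be * (\1_(Q i) x * u x))%R &
   forall x, D (i :: s) x = (D s x + (al * (\1_(Q i) x * (g x * u x))
       - be * (\1_(Q i) x * u x)))%R].
Proof.
move=> /(max_over_cst a)[c [c0 cE]].
have [ac|ca] := leP (a i) c.
  exists 0%R, 0%R; rewrite mul0r; split => // x.
    rewrite mul0r addr0 /P /M max_over_cons indicE; have [/set_mem Qx|] := boolP (x \in _).
      by rewrite (max_r (_ : a i * 1%R <= _)%R)// cE// mulr1.
    by rewrite mulr0 max_r// max_over_ge0.
  rewrite !mul0r subrr addr0 /D /P /M max_over_cons indicE.
  have [/set_mem Qx|] := boolP (x \in _).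
    by rewrite (max_r (_ : a i * 1%R <= _)%R)// cE// mulr1.
  by rewrite mulr0 max_r// max_over_ge0.
exists (q * (a i `^ (p - 1) - c `^ (p - 1)))%R, (a i `^ p - c `^ p)%R.
have mono r : (0 <= r)%R -> (0 <= a i `^ r - c `^ r)%R.
  by move=> r0; rewrite subr_ge0; apply: ge0_ler_powR; rewrite ?nnegrE// ltW.
split => //.
- rewrite mulrAC; apply: powR_subr_le => //.
- by apply: mulr_ge0; [apply: divr_ge0|apply: mono]; move: p1; lra.
- by apply: mono; move: p1; lra.
- move=> x; rewrite /P /M max_over_cons indicE.
  have [/set_mem Qx|] := boolP (x \in _); last first.
    by rewrite mulr0 max_r ?max_over_ge0// mul0r mulr0 addr0.
  by rewrite mulr1 mul1r cE// max_l ?(ltW ca)//; ring.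
move=> x; rewrite /D /P /M max_over_cons indicE.
have [/set_mem Qx|] := boolP (x \in _); last first.
  by rewrite mulr0 max_r ?max_over_ge0// !mul0r !mulr0 subrr addr0.
by rewrite mulr1 !mul1r cE// max_l ?(ltW ca)//; ring.
Qed.

Lemma integrable_indicM (A : set T) (f : T -> R) : measurable A ->
  (forall x, (0 <= f x)%R) -> measurable_fun setT f ->
  \int[mu]_(x in A) (f x)%:E < +oo ->
  mu.-integrable setT (fun x => (\1_A x * f x)%:E) /\
  \int[mu]_x (\1_A x * f x)%:E = \int[mu]_(x in A) (f x)%:E.
Proof.
move=> mA f0 mf fA.
have e : \int[mu]_x (\1_A x * f x)%:E = \int[mu]_(x in A) (f x)%:E.
  rewrite [RHS]integral_mkcond; apply: eq_integral => x _.
  by rewrite patchE indicE; case: ifP; rewrite ?mul1r ?mul0r.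
split=> //; apply/integrableP; split.
  by apply/measurable_EFinP/measurable_funM => //; exact: measurable_indic.
under eq_integral => x _ do rewrite gee0_abs ?lee_fin ?mulr_ge0 ?indicE//.
by under eq_integral => x _ do rewrite -indicE; rewrite e.
Qed.

(* Adding the sets from the largest to the smallest, the maximal function is
   constant on each newly added set, so that every step contributes a
   nonnegative multiple of [\int_(Q i) g u - a i \int_(Q i) u] to
   [\int p' g M^(p-1) u - M^p u]. *)
Lemma doob_refining s : refining s ->
  (forall i, i \in s -> \int[mu]_(x in Q i) (u x)%:E < +oo) ->
  (forall i, i \in s -> \int[mu]_(x in Q i) (g x * u x)%:E < +oo) ->
  (forall i, i \in s -> (a i)%:E * \int[mu]_(x in Q i) (u x)%:E <=
                \int[mu]_(x in Q i) (g x * u x)%:E) ->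
  \int[mu]_x (max_over a s x `^ p * u x)%:E <=
  (doob_cst p)%:E * \int[mu]_x (g x `^ p * u x)%:E.
Proof.
move=> rs uQ guQ aQ.
rewrite /doob_cst -/q.
have q0 : (0 <= q)%R by apply: divr_ge0; move: p1; lra.
have p1' : (0 < p - 1)%R by rewrite subr_gt0.
have p0 : (0 < p)%R by move: p1; lra.
(* Integrability is carried along because [D] has no sign and the integral of [P / 2 + D] must be
   split below. *)
have [iP [iD D0]] : [/\ mu.-integrable setT (EFin \o P s),
    mu.-integrable setT (EFin \o D s) & 0 <= \int[mu]_x (D s x)%:E].
  elim: s rs uQ guQ aQ => [|i s IH] rs uQ guQ aQ.
    have PE : P [::] = cst 0%R.
      by apply/funext => x; rewrite /P /M /max_over big_nil powR0 ?mul0r// gt_eqF.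
    have DE : D [::] = cst 0%R.
      apply/funext => x; rewrite /D PE /M /max_over big_nil powR0 ?mul0r ?gt_eqF//.
      by rewrite mulr0 mul0r subr0.
    by rewrite PE DE; split; [exact: integrable0|exact: integrable0|rewrite integral0].
  have [al [be [ab al0 be0 PE DE]]] := step rs.
  have [iP [iD D0]] : [/\ mu.-integrable setT (EFin \o P s),
     mu.-integrable setT (EFin \o D s) & 0 <= \int[mu]_x (D s x)%:E].
    case: rs => _ rs; apply: IH => // j js; [apply: uQ|apply: guQ|apply: aQ];
    by rewrite inE js orbT.
  have is_ : i \in i :: s by rewrite mem_head.
  have [i1 e1] := integrable_indicM (mQ i) u0 mu_ (uQ _ is_).
  have [i2 e2] := integrable_indicM (mQ i) (fun x => mulr_ge0 (g0 x) (u0 x))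
     (measurable_funM mg mu_) (guQ _ is_).
  have i1' := @integrableZl _ _ _ mu _ measurableT be _ i1.
  have i2' := @integrableZl _ _ _ mu _ measurableT al _ i2.
  have i3 := integrableB measurableT i2' i1'.
  split.
  - rewrite (_ : EFin \o P (i :: s) =
     (EFin \o P s) \+ (fun x => be%:E * (\1_(Q i) x * u x)%:E)); last first.
      by apply/funext => x /=; rewrite PE EFinD EFinM.
    exact: integrableD.
  - rewrite (_ : EFin \o D (i :: s) = (EFin \o D s) \+
     ((fun x => al%:E * (\1_(Q i) x * (g x * u x))%:E) \-
      (fun x => be%:E * (\1_(Q i) x * u x)%:E))); last first.
      by apply/funext => x /=; rewrite DE EFinD EFinB !EFinM.
    exact: integrableD.
  - under eq_integral => x _ do rewrite DE EFinD (EFinB (al * _)%R) (EFinM al) (EFinM be).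
    have -> : \int[mu]_x ((D s x)%:E + (al%:E * (\1_(Q i) x * (g x * u x))%:E
        - be%:E * (\1_(Q i) x * u x)%:E)) = \int[mu]_x (D s x)%:E +
        (al%:E * \int[mu]_(x in Q i) (g x * u x)%:E -
         be%:E * \int[mu]_(x in Q i) (u x)%:E).
      rewrite -e1 -e2 -!integralZl// integralD//; congr (_ + _).
      exact: integralB.
    rewrite adde_ge0// sube_ge0; last first.
      by rewrite fin_numM// ge0_fin_numE ?integral_ge0// ?uQ// => x _; rewrite lee_fin.
    apply: le_trans (lee_wpmul2l _ (aQ _ is_)); last by rewrite lee_fin.
    by rewrite muleA lee_wpmul2r// ?lee_fin// integral_ge0// => x _; rewrite lee_fin.
set K := (q * _)%R.
have K0 : (0 <= K)%R by rewrite mulr_ge0// powR_ge0.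
have mgp : measurable_fun setT (fun x => (g x `^ p * u x)%R).
  apply: measurable_funM => //; exact: measurable_fun_powRl.
have gp0 x : (0 <= g x `^ p * u x)%R by rewrite mulr_ge0// powR_ge0.
have [->|] := eqVneq (\int[mu]_x (g x `^ p * u x)%:E) +oo.
  have q0' : (0 < q)%R by exact: divr_gt0.
  have : (0 < K)%R by rewrite mulr_gt0// powR_gt0// mulr_gt0.
  by move=> K0'; rewrite gt0_muley ?leey// lte_fin mulr_gt0.
rewrite -ltey => gfin.
have ig : mu.-integrable setT (fun x => (g x `^ p * u x)%:E).
  apply/integrableP; split; first exact/measurable_EFinP.
  by under eq_integral => x _ do rewrite gee0_abs ?lee_fin//.
have iK := @integrableZl _ _ _ mu _ measurableT K _ ig.
have iP2 := @integrableZl _ _ _ mu _ measurableT 2^-1%R _ iP.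
(* This is [young_absorb] pointwise, with [P] subtracted on both sides. Dropping the nonnegative
   [\int D] then leaves the bound on [\int P]. *)
have : \int[mu]_x (2^-1%:E * (P s x)%:E + (D s x)%:E) <=
       \int[mu]_x (K%:E * (g x `^ p * u x)%:E).
  apply: le_integral => //; first exact: integrableD.
  move=> x _; rewrite -!EFinM -EFinD lee_fin /D.
  have := young_absorb p1 (g0 x) (max_over_ge0 a s x).
  rewrite -/q -/(M s x) -/K => /(ler_wpM2r (u0 x)).
  rewrite !mulrDl /P.
  set X := (M s x `^ p)%R; set Y := (M s x `^ (p - 1))%R; lra.
rewrite integralD//= !integralZl// => h.
have h2 : 2^-1%:E * \int[mu]_x (P s x)%:E <= K%:E * \int[mu]_x (g x `^ p * u x)%:E.
  by apply: le_trans h; rewrite leeDl.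
rewrite EFinM -muleA; apply: le_trans (lee_wpmul2l _ h2); last by rewrite lee_fin.
by rewrite muleA -EFinM mulfV ?mul1e.
Qed.

End doob.

(** * Lerner's estimate for a finite family of nested sets *)

Section lerner.
Local Open Scope ereal_scope.
Context d (T : measurableType d) (R : realType).
Variable mu : {measure set T -> \bar R}.
Context (I : eqType) (Q : I -> set T).
Implicit Types (a : I -> R) (s : seq I).

(** Used with [phi y = y^(p-1) / A], to apply Doob's inequality to the transformed means instead of
    the means themselves. *)
Lemma max_over_map (phi : R -> R) a s x : phi 0%R = 0%R ->
  {homo phi : y z / (0 <= y <= z)%R >-> (y <= z)%R} -> (forall i, (0 <= a i)%R) ->
  max_over Q (phi \o a) s x = phi (max_over Q a s x).
Proof.
move=> phi0 ndphi a0; elim: s => [|i s IH]; first by rewrite /max_over !big_nil.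
rewrite !max_over_cons IH indicE; case: (x \in Q i); rewrite ?mulr1 ?mulr0 /=.
  have m0 := max_over_ge0 Q a s x.
  have [h|/ltW h] := leP (a i) (max_over Q a s x).
    by rewrite max_r// ndphi// a0.
  by rewrite max_l// ndphi// m0.
by rewrite !max_r ?max_over_ge0// -phi0 ndphi// lexx max_over_ge0.
Qed.

(** A crude bound that serves only to show certain integrals finite; it enters no constant. *)
Lemma max_over_le_sum a s x : (forall i, (0 <= a i)%R) ->
  (max_over Q a s x <= \sum_(i <- s) a i)%R.
Proof.
move=> a0; elim: s => [|i s IH]; first by rewrite /max_over !big_nil.
rewrite max_over_cons big_cons ge_max; apply/andP; split; last first.
  exact: ler_wpDl.
apply: ler_wpDr; first exact: sumr_ge0.
by rewrite indicE; case: (x \in Q i); rewrite ?mulr1 ?mulr0.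
Qed.

Lemma integral_gt0 (A : set T) (f : T -> R) : measurable A ->
  (forall x, (0 < f x)%R) -> measurable_fun setT f ->
  0 < mu A -> 0 < \int[mu]_(x in A) (f x)%:E.
Proof.
move=> mA f0 mf A0; rewrite lt0e integral_ge0 ?andbT; last first.
  by move=> x _; rewrite lee_fin ltW.
apply/eqP => h.
have mf' : measurable_fun A (EFin \o f).
  by apply/measurable_EFinP; exact: measurable_funTS.
have : \int[mu]_(x in A) `|(EFin \o f) x| = 0.
  rewrite -h; apply: eq_integral => x _ /=.
  by rewrite ger0_norm// ltW.
move/(ae_eq_integral_abs mu mA mf') => [N [mN N0 sub]].
have : mu A <= mu N.
  apply: le_measure; rewrite ?inE//.
  move=> x Ax; apply: sub => /= /(_ Ax) /eqP.
  by rewrite eqe gt_eqF.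
by rewrite N0 leNgt A0.
Qed.

Variables (p A : R) (w f : T -> R) (s : seq I).
Hypotheses (p1 : (1 < p)%R) (A0 : (0 < A)%R).
Hypotheses (w0 : forall x, (0 < w x)%R) (mw : measurable_fun setT w).
Hypotheses (f0 : forall x, (0 <= f x)%R) (mf : measurable_fun setT f).
Let sg x := (w x `^ (- (p - 1)^-1))%R.
Hypotheses (mQ : forall i, measurable (Q i)) (rs : refining Q s).
Hypothesis muQ : forall i, 0 < mu (Q i) < +oo.
Hypothesis wQ : forall i, \int[mu]_(x in Q i) (w x)%:E < +oo.
Hypothesis sgQ : forall i, \int[mu]_(x in Q i) (sg x)%:E < +oo.
Hypothesis fQ : forall i, \int[mu]_(x in Q i) (f x)%:E < +oo.
Hypothesis ApQ : forall i,
  (fine (\int[mu]_(x in Q i) (w x)%:E) *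
   fine (\int[mu]_(x in Q i) (sg x)%:E) `^ (p - 1) <= A * fine (mu (Q i)) `^ p)%R.

Let m i := fine (mu (Q i)).
Let W i := fine (\int[mu]_(x in Q i) (w x)%:E).
Let S i := fine (\int[mu]_(x in Q i) (sg x)%:E).
Let F i := fine (\int[mu]_(x in Q i) (f x)%:E).

Definition mean (i : I) := (F i / m i)%R.

(** [ApQ] is the A_p condition multiplied by [|Q|^p]. The two applications of Doob's inequality fit
    together because [(f / sg)^p sg = f^p w] and [(N^(p-1) / w)^p' w = N^p sg]: changing from one
    weight to the other costs nothing. *)
Lemma lerner_refining :
  \int[mu]_x (max_over Q mean s x `^ p * w x)%:E <=
  (A `^ (p / (p - 1)) * doob_cst (p / (p - 1)) * doob_cst p)%:E *
    \int[mu]_x (f x `^ p * w x)%:E.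
Proof.
have p1' : (0 < p - 1)%R by rewrite subr_gt0.
have p0 : (0 < p)%R by move: p1; lra.
have p1n0 : (p - 1 != 0)%R by rewrite gt_eqF.
set p' := (p / (p - 1))%R.
have p'1 : (1 < p')%R by rewrite /p' ltr_pdivlMr//; lra.
have sg0 x : (0 < sg x)%R by exact: powR_gt0.
have msg : measurable_fun setT sg by exact: measurable_fun_powRl.
have mi0 i : (0 < m i)%R by rewrite fine_gt0.
have Si0 i : (0 < S i)%R by rewrite fine_gt0// sgQ integral_gt0//; have /andP[] := muQ i.
have Fi0 i : (0 <= F i)%R by rewrite fine_ge0// integral_ge0// => x _; rewrite lee_fin.
have mE i : mu (Q i) = (m i)%:E.
  by rewrite fineK// ge0_fin_numE//; have /andP[] := muQ i.
have WE i : \int[mu]_(x in Q i) (w x)%:E = (W i)%:E.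
  by rewrite fineK// ge0_fin_numE ?wQ// integral_ge0// => x _; rewrite lee_fin ltW.
have SE i : \int[mu]_(x in Q i) (sg x)%:E = (S i)%:E.
  by rewrite fineK// ge0_fin_numE ?sgQ// integral_ge0// => x _; rewrite lee_fin ltW.
have FE i : \int[mu]_(x in Q i) (f x)%:E = (F i)%:E.
  by rewrite fineK// ge0_fin_numE ?fQ// integral_ge0// => x _; rewrite lee_fin.
(* The mean of [f / sg] over [Q i] for the measure [sg dmu]. *)
pose a i := (F i / S i)%R.
have a0 i : (0 <= a i)%R by rewrite divr_ge0// ltW.
have mean0 i : (0 <= mean i)%R by rewrite divr_ge0// ltW.
pose N x := max_over Q a s x.
have N0 x : (0 <= N x)%R by exact: max_over_ge0.
have mN : measurable_fun setT N by exact: measurable_max_over.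
pose g x := (f x / sg x)%R.
have g0 x : (0 <= g x)%R by rewrite divr_ge0// ltW.
have mg : measurable_fun setT g.
  apply: measurable_funM => //.
  rewrite (_ : (fun x => (sg x)^-1%R) = (fun x => sg x `^ (-1))%R).
    exact: measurable_fun_powRl.
  by apply/funext => x; rewrite powR_inv1// ltW.
have gE x : (g x * sg x = f x)%R by rewrite /g divfK// gt_eqF.
have gpE x : (g x `^ p * sg x = f x `^ p * w x)%R.
  rewrite /g powRM ?invr_ge0 ?(ltW (sg0 x))// -powR_inv1 ?ltW// -mulrA; congr (_ * _)%R.
  rewrite /sg -!powRrM -powRD; last by rewrite (gt_eqF (w0 x)) implybT.
  rewrite (_ : (_ + _)%R = 1%R) ?powRr1// ?ltW//.
  by field.
have step1 : \int[mu]_x (N x `^ p * sg x)%:E <=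
    (doob_cst p)%:E * \int[mu]_x (f x `^ p * w x)%:E.
  have := @doob_refining _ _ _ mu _ Q p sg g a p1 mQ (fun x => ltW (sg0 x)) msg g0 mg a0 s rs.
  under [in X in _ -> _ -> _ -> _ <= _ * X]eq_integral do rewrite gpE.
  apply => i _.
  - exact: sgQ.
  - by under eq_integral do rewrite gE.
  - under [leRHS]eq_integral do rewrite gE.
    by rewrite SE FE -EFinM /a divfK// gt_eqF.
pose h x := (N x `^ (p - 1) / w x)%R.
have h0 x : (0 <= h x)%R by rewrite divr_ge0 ?powR_ge0// ltW.
have hE x : (h x * w x = N x `^ (p - 1))%R by rewrite /h divfK// gt_eqF.
have mh : measurable_fun setT h.
  apply: measurable_funM; first exact: measurable_fun_powRl.
  rewrite (_ : (fun x => (w x)^-1%R) = (fun x => w x `^ (-1))%R).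
    exact: measurable_fun_powRl.
  by apply/funext => x; rewrite powR_inv1// ltW.
have hpE x : (h x `^ p' * w x = N x `^ p * sg x)%R.
  rewrite /h powRM ?powR_ge0 ?invr_ge0 ?(ltW (w0 x))// -powR_inv1 ?ltW// -powRrM -mulrA.
  congr (_ `^ _ * _)%R; first by rewrite /p'; field.
  rewrite -powRrM -[X in (_ * X)%R = _]powRr1 ?ltW// -powRD; last first.
    by rewrite (gt_eqF (w0 x)) implybT.
  by congr (_ `^ _)%R; rewrite /p'; field.
pose phi y := (y `^ (p - 1) / A)%R.
have phi0 : phi 0%R = 0%R by rewrite /phi powR0 ?mul0r.
have ndphi : {homo phi : y z / (0 <= y <= z)%R >-> (y <= z)%R}.
  move=> y z /andP[y0 yz]; rewrite /phi ler_wpM2r ?invr_ge0 ?(ltW A0)//.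
  by apply: ge0_ler_powR; rewrite ?nnegrE ?(ltW p1')//; exact: le_trans yz.
have phi_ge0 y : (0 <= phi y)%R by rewrite divr_ge0 ?powR_ge0 ?ltW.
have mNp : measurable_fun setT (fun x => N x `^ (p - 1))%R by exact: measurable_fun_powRl.
have step2 : \int[mu]_x (max_over Q (phi \o mean) s x `^ p' * w x)%:E <=
    (doob_cst p')%:E * \int[mu]_x (N x `^ p * sg x)%:E.
  have := @doob_refining _ _ _ mu _ Q p' w h (phi \o mean) p'1 mQ
    (fun x => ltW (w0 x)) mw h0 mh (fun=> phi_ge0 _) s rs.
  under [in X in _ -> _ -> _ -> _ <= _ * X]eq_integral do rewrite hpE.
  apply => i si.
  - exact: wQ.
  - under eq_integral do rewrite hE.
    pose B := ((\sum_(i <- s) a i) `^ (p - 1))%R.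
    apply: (@le_lt_trans _ _ (\int[mu]_(x in Q i) B%:E)).
      apply: ge0_le_integral => //.
      - by move=> x _; rewrite lee_fin powR_ge0.
      - by apply/measurable_EFinP/measurable_funTS.
      - move=> x _; rewrite lee_fin; apply: ge0_ler_powR; rewrite ?nnegrE ?(ltW p1')//.
          exact: sumr_ge0.
        exact: max_over_le_sum.
    by rewrite integral_cst// mE -EFinM ltry.
  - under [leRHS]eq_integral do rewrite hE.
    (* On [Q i] the function [N] is at least the constant [a i]; what remains is [ApQ] for this one
       set. *)
    apply: (@le_trans _ _ (\int[mu]_(x in Q i) (a i `^ (p - 1))%:E)); last first.
      apply: ge0_le_integral => //.
      - by move=> x _; rewrite lee_fin powR_ge0.
      - by apply/measurable_EFinP/measurable_funTS.
      - move=> x Qx; rewrite lee_fin; apply: ge0_ler_powR; rewrite ?nnegrE ?(ltW p1')//.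
        exact: le_max_over.
    rewrite integral_cst// mE WE -!EFinM lee_fin /= /phi /mean /a.
    rewrite !powRM ?invr_ge0 ?(ltW (mi0 _)) ?(ltW (Si0 _))//.
    rewrite -(powR_inv1 (ltW (mi0 i))) -(powR_inv1 (ltW (Si0 i))) -!powRrM !mulN1r.
    rewrite !powRN -!mulrA ler_wpM2l ?powR_ge0//.
    have := ApQ i; rewrite -/(m i) -/(W i) -/(S i).
    rewrite -(mulr_powRB1 (ltW (mi0 i)) p0).
    set Y := (m i `^ (p - 1))%R; set Z := (S i `^ (p - 1))%R => hA.
    have Y0 : (0 < Y)%R by exact: powR_gt0.
    have Z0 : (0 < Z)%R by exact: powR_gt0.
    rewrite -(ler_pM2l Y0) -(ler_pM2l A0) -(ler_pM2r Z0).
    rewrite [leLHS](_ : _ = W i * Z)%R; last by field; rewrite !gt_eqF.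
    by rewrite [leRHS](_ : _ = A * (m i * Y))%R//; field; rewrite !gt_eqF.
(* Here [A] enters, with exponent [p']; the power [p] of the maximum comes back since
   [(p - 1) p' = p]. *)
have e x : (max_over Q mean s x `^ p * w x)%R =
    (A `^ p' * (max_over Q (phi \o mean) s x `^ p' * w x))%R.
  rewrite max_over_map// /phi powRM ?powR_ge0 ?invr_ge0 ?(ltW A0)//.
  rewrite -(powR_inv1 (ltW A0)) -!powRrM mulN1r powRN.
  rewrite (_ : ((p - 1) * p')%R = p); last by rewrite /p'; field.
  by field; rewrite gt_eqF// powR_gt0.
under eq_integral do rewrite e EFinM.
rewrite ge0_integralZl_EFin ?powR_ge0//; last 2 first.
- by move=> x _; rewrite lee_fin mulr_ge0 ?powR_ge0// ltW.
- apply/measurable_EFinP/measurable_funM => //; apply: measurable_fun_powRl.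
  exact: measurable_max_over.
have -> : (A `^ p' * doob_cst p' * doob_cst p)%:E =
    (A `^ p')%:E * ((doob_cst p')%:E * (doob_cst p)%:E) by rewrite -!EFinM mulrA.
rewrite -muleA; apply: lee_wpmul2l; first by rewrite lee_fin powR_ge0.
apply: (le_trans step2); rewrite -muleA; apply: lee_wpmul2l => //.
by rewrite lee_fin doob_cst_ge0.
Qed.

End lerner.

(** * Boxes and shifted dyadic grids *)

Section boxes.
Variables (R : realType) (n : nat).
Local Notation mu := (@lebesgue R n).

Let measurable_boxB (A : 'I_n -> set (measurableTypeR R)) :
  (forall i, measurable (A i)) ->
  measurable [set t : n.-tuple (measurableTypeR R) | forall i, A i (tnth t i)].
Proof.
move=> mA; rewrite [X in measurable X](_ : _ = \bigcap_(i in [set: 'I_n])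
    ((fun t : n.-tuple (measurableTypeR R) => tnth t i) @^-1` A i)).
  apply: fin_bigcap_measurable => // i _.
  by rewrite -[X in measurable X]setTI; exact: measurable_tnth.
by apply/seteqP; split=> [t At i _|t At i] /=; exact: At.
Qed.

Lemma measurable_borel (A : set (n.-tuple (measurableTypeR R))) :
  measurable A -> measurable (A : set (euclid R n)).
Proof. by move=> mA; apply: sub_caratheodory; exact: sub_sigma_algebra. Qed.

Lemma measurable_box (A : 'I_n -> set (measurableTypeR R)) :
  (forall i, measurable (A i)) ->
  measurable ([set t | forall i, A i (tnth t i)] : set (euclid R n)).
Proof. by move=> mA; apply: measurable_borel; exact: measurable_boxB. Qed.

Lemma lebesgue_box (A : 'I_n -> set (measurableTypeR R)) :
  (forall i, measurable (A i)) ->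
  mu [set t | forall i, A i (tnth t i)] = (\prod_(i < n) lebesgue_measure (A i))%E.
Proof.
move=> mA; rewrite -(borel_lebesgue_box mA).
by rewrite /lebesgue /completed_measure_extension /= measurable_mu_extE//; exact: measurable_boxB.
Qed.

Lemma measurable_coord (i : 'I_n) :
  measurable_fun setT (fun x : euclid R n => tnth (x : n.-tuple R) i : measurableTypeR R).
Proof.
move=> _ B mB; rewrite setTI; apply: measurable_borel.
by rewrite -[X in measurable X]setTI; exact: measurable_tnth.
Qed.

Lemma cubeE (a : n.-tuple R) (l : R) : cube a l =
  [set t | forall i, [set` `[tnth a i, tnth a i + l]] (tnth t i)].
Proof.
apply/seteqP; split=> [t At i|t At i] /=.
  by rewrite in_itv /=; apply/andP; exact: At.
by have := At i; rewrite /= in_itv /= => /andP.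
Qed.

Lemma measurable_cube (a : n.-tuple R) (l : R) : measurable (cube a l).
Proof.
rewrite cubeE; apply: (measurable_box (A := fun i => [set` `[tnth a i, tnth a i + l]])) => i.
exact: measurable_itv.
Qed.

End boxes.

Lemma exprN1z (R : unitRingType) (k : int) : (-1) ^ k = (-1) ^+ `|k|%N :> R.
Proof. by case: k => k //; rewrite NegzE -exprnN invr_sign. Qed.

Section dyadic_coordinate.
Variable R : realType.
Implicit Types (e : bool) (k : int) (x y : R).

(* The grid [e = true] is the one of the one-third trick: at scale [2^-k] it is
   shifted by [(-1)^k / 3] times the scale, and remains nested because twice
   the shift differs from the opposite shift by an integer. *)
Definition grid_shift e k : R := if e then (-1) ^ k / 3 else 0.

Definition dyadic e k x : int := Num.floor (2 ^ k * x - grid_shift e k).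

(** Comparing [(y - d) / 2] with an integer [N] amounts to comparing [y] with the integer [2 N + d],
    which the floor of [y] decides. *)
Lemma floor_half_eq (d : int) (y z : R) : Num.floor y = Num.floor z ->
  Num.floor ((y - d%:~R) / 2) = Num.floor ((z - d%:~R) / 2).
Proof.
move=> yz; apply/esym/floor_def.
have /andP[] := floor_itv ((y - d%:~R) / 2).
set N := Num.floor _ => N1 N2.
have h1 : N * 2 + d <= Num.floor z.
  by rewrite -yz floor_ge_int rmorphD rmorphM /=; lra.
have h2 : Num.floor z < N * 2 + d + 2.
  by rewrite -yz floor_lt_int !rmorphD rmorphM /=; move: N2; rewrite rmorphD /=; lra.
move: h1 h2; rewrite floor_ge_int floor_lt_int !rmorphD rmorphM /= => h1 h2.
by apply/andP; split; lra.
Qed.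

(** In rescaled coordinates, passing to the coarser scale is [y -> (y - d) / 2], with [d = 0] for
    the plain grid and [d = (-1)^k] for the shifted one, because
    [2 (-1)^k / 3 = (-1)^k + (-1)^(k+1) / 3]. *)
Lemma dyadic_pred e k x y :
  dyadic e (k + 1) x = dyadic e (k + 1) y -> dyadic e k x = dyadic e k y.
Proof.
have [d dE] : exists d : int, forall x : R, 2 ^ k * x - grid_shift e k =
   (2 ^ (k + 1) * x - grid_shift e (k + 1) - d%:~R) / 2.
  case: e; last first.
    by exists 0 => z; rewrite /grid_shift expfzDr// expr1z subr0 mulr0z; field.
  exists ((-1) ^ k) => z; rewrite /grid_shift !expfzDr ?oppr_eq0// !expr1z.
  have -> : (((-1) ^ k : int)%:~R : R) = (-1) ^ k by rewrite !exprN1z rmorph_sign.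
  by field.
by rewrite /dyadic !dE; exact: floor_half_eq.
Qed.

Lemma dyadic_le e j k x y : j <= k ->
  dyadic e k x = dyadic e k y -> dyadic e j x = dyadic e j y.
Proof.
move=> jk; have -> : k = j + `|k - j|%N by rewrite gez0_abs ?subr_ge0// subrKC.
elim: `|k - j|%N => [|m IH]; first by rewrite addr0.
by rewrite intS [1 + _]addrC addrA => /dyadic_pred.
Qed.

Lemma dyadic_fiber e k (m : int) : [set x | dyadic e k x = m] =
  [set` `[2 ^ (- k) * (m%:~R + grid_shift e k), 2 ^ (- k) * (m%:~R + grid_shift e k) + 2 ^ (- k)[].
Proof.
have k0 : 0 < 2 ^ k :> R by exact: exprz_gt0.
apply/seteqP; split => x /=; rewrite in_itv /= -invr_expz -[X in _ < _ + X]mulr1 -mulrDr.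
  move=> <-; have /andP[] := floor_itv (2 ^ k * x - grid_shift e k).
  rewrite -/(dyadic e k x) rmorphD /= => h1 h2.
  by rewrite ler_pdivrMl// ltr_pdivlMl//; apply/andP; split; lra.
rewrite ler_pdivrMl// ltr_pdivlMl// => /andP[h1 h2].
by apply/floor_def; rewrite rmorphD /=; apply/andP; split; lra.
Qed.

(** A segment cut in both grids would contain a cell endpoint of each. In units of [2^-k] these are
    an integer and an integer shifted by a third, hence at least 1/3 apart, while the segment has
    length at most 1/3. Its left end is excluded, which settles the case of equality. *)
Lemma dyadic_cover k a l : 0 <= l -> 3 * l * 2 ^ k <= 1 ->
  exists e, forall x, a <= x <= a + l -> dyadic e k x = dyadic e k a.
Proof.
move=> l0 hl; have k0 : 0 < 2 ^ k :> R by exact: exprz_gt0.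
suff [e he] : exists e, dyadic e k (a + l) = dyadic e k a.
  exists e => x /andP[ax xl]; apply/eqP; rewrite eq_le -{1}he.
  by apply/andP; split; apply: le_floor; rewrite lerB// ler_pM2l.
have [h|h] := eqVneq (dyadic false k (a + l)) (dyadic false k a); first by exists false.
have [h'|h'] := eqVneq (dyadic true k (a + l)) (dyadic true k a); first by exists true.
exfalso.
have low e : dyadic e k (a + l) != dyadic e k a ->
    2 ^ k * a < (dyadic e k (a + l))%:~R + grid_shift e k <= 2 ^ k * (a + l).
  move=> ne; have le : dyadic e k a <= dyadic e k (a + l).
    by apply: le_floor; rewrite lerB// ler_pM2l// lerDl.
  have : dyadic e k a < dyadic e k (a + l) by rewrite lt_neqAle eq_sym ne.
  rewrite {1}/dyadic floor_lt_int => h1.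
  have := floor_le (2 ^ k * (a + l) - grid_shift e k); rewrite -/(dyadic _ _ _) => h2.
  by apply/andP; split; lra.
have /andP[] := low _ h; have /andP[] := low _ h'.
set P := dyadic true _ _; set P' := dyadic false _ _.
rewrite /grid_shift addr0.
have : (-1) ^ k = 1 :> R \/ (-1) ^ k = -1 :> R.
  by rewrite exprN1z -signr_odd; case: odd; [right|left].
set S := (-1) ^ k => hS h1 h2 h3 h4.
have h5 : 3 * (2 ^ k * (a + l) - 2 ^ k * a) <= 1.
  by rewrite [leLHS](_ : _ = 3 * l * 2 ^ k)//; ring.
have [PP|PP|PP] := ltgtP P P'.
- have : (P + 1)%:~R <= P'%:~R :> R by rewrite ler_int -ltzD1 ltrD2r.
  by rewrite rmorphD /=; case: hS => hS; rewrite hS in h1 h2; lra.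
- have : (P' + 1)%:~R <= P%:~R :> R by rewrite ler_int -ltzD1 ltrD2r.
  by rewrite rmorphD /=; case: hS => hS; rewrite hS in h1 h2; lra.
- by rewrite PP in h1 h2; case: hS => hS; rewrite hS in h1 h2; lra.
Qed.

Lemma dyadic_scale (y : R) : 0 < y -> exists k : int, 2 ^ k <= y < 2 * 2 ^ k.
Proof.
move=> y0; have l2 : 0 < ln 2 :> R by rewrite ln_gt0// ltr1n.
exists (Num.floor (ln y / ln 2)).
have e (k : int) : 2 ^ k = expR (k%:~R * ln 2) :> R.
  by rewrite -powR_intmul// /powR gt_eqF.
have := floor_itv (ln y / ln 2); set k := Num.floor _.
rewrite ler_pdivlMr// ltr_pdivrMr// => /andP[h1 h2].
have -> : 2 * 2 ^ k = 2 ^ (k + 1) :> R by rewrite expfzDr// expr1z mulrC.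
have -> : y = expR (ln y) by rewrite lnK.
by rewrite !e ler_expR ltr_expR h1.
Qed.

End dyadic_coordinate.

Section grids.
Variables (R : realType) (n : nat).
Local Notation mu := (@lebesgue R n).
Local Notation index := (int * n.-tuple int)%type.
Implicit Types (e : n.-tuple bool) (j : index).

(** Each coordinate picks its own one-dimensional grid through [e], whence [2^n] grids. An index is
    a scale with integer positions, so that the cells of a grid are countable. *)
Definition cell e j : set (euclid R n) := [set x : n.-tuple R |
  forall i, dyadic (tnth e i) j.1 (tnth x i) = tnth j.2 i].

Lemma cellE e j : cell e j = [set t | forall i,
  [set` `[2 ^ (- j.1) * ((tnth j.2 i)%:~R + grid_shift R (tnth e i) j.1),
     2 ^ (- j.1) * ((tnth j.2 i)%:~R + grid_shift R (tnth e i) j.1) + 2 ^ (- j.1)[]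
  (tnth t i)].
Proof.
by apply/seteqP; split => x h i; have := h i; rewrite -(dyadic_fiber R _ j.1).
Qed.

Lemma measurable_cell e j : measurable (cell e j).
Proof.
rewrite cellE; apply: (measurable_box (A := fun i : 'I_n =>
  [set` `[2 ^ (- j.1) * ((tnth j.2 i)%:~R + grid_shift R (tnth e i) j.1),
     2 ^ (- j.1) * ((tnth j.2 i)%:~R + grid_shift R (tnth e i) j.1) + 2 ^ (- j.1)[])) => i.
exact: measurable_itv.
Qed.

Lemma lebesgue_cell e j : mu (cell e j) = ((2 ^ (- j.1)) ^+ n)%:E.
Proof.
rewrite cellE (lebesgue_box (A := fun i : 'I_n =>
  [set` `[2 ^ (- j.1) * ((tnth j.2 i)%:~R + grid_shift R (tnth e i) j.1),
     2 ^ (- j.1) * ((tnth j.2 i)%:~R + grid_shift R (tnth e i) j.1) + 2 ^ (- j.1)[])); last first.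
  by move=> i; exact: measurable_itv.
rewrite (eq_bigr (fun=> (2 ^ (- j.1))%:E)) => [|i _].
  by rewrite prodEFin big_const_ord iter_mulr_1.
rewrite lebesgue_measure_itv /= lte_fin ltrDl exprz_gt0//.
by rewrite -EFinB addrC addKr.
Qed.

(** The closed cube has the same measure as the half-open cell, so the A_p condition and local
    finiteness, assumed for closed cubes, pass to cells without loss. *)
Lemma cell_sub_cube e j : exists a, cell e j `<=` cube a (2 ^ (- j.1)).
Proof.
exists [tuple 2 ^ (- j.1) * ((tnth j.2 i)%:~R + grid_shift R (tnth e i) j.1) | i < n].
rewrite cellE cubeE => x /= h i; rewrite tnth_mktuple.
by have := h i; apply: subset_itvl; rewrite bnd_simp.
Qed.

Lemma cell_nested e j j' : j'.1 <= j.1 ->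
  cell e j `<=` cell e j' \/ cell e j `&` cell e j' = set0.
Proof.
move=> jj; have [|/set0P[y [yj yj']]] := eqVneq (cell e j `&` cell e j') set0.
  by right.
left => x xj i; rewrite -(yj' i); apply: dyadic_le jj _.
by rewrite (xj i) (yj i).
Qed.

(** A finite exhaustion of a grid by the indices with code below [N], sorted with the small cells
    first as [refining] demands. *)
Definition grid (N : nat) : seq index :=
  sort (fun j j' : index => j'.1 <= j.1) (pmap unpickle (iota 0 N)).

Lemma refining_grid e N : refining (cell e) (grid N).
Proof.
have tr : transitive (fun j j' : index => j'.1 <= j.1).
  by move=> y x z /= h1 h2; exact: le_trans h2 h1.
have : sorted (fun j j' : index => j'.1 <= j.1) (grid N).
  by apply: sort_sorted => x y /=; exact: le_total.
elim: (grid N) => //= j s IH js; split; last exact/IH/(path_sorted js).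
move=> j' j's; apply: cell_nested.
by move/(order_path_min tr)/allP: js => /(_ _ j's).
Qed.

Lemma mem_grid N j : (j \in grid N) = (j \in pmap unpickle (iota 0 N)).
Proof. exact: mem_sort. Qed.

Lemma pickle_grid j : j \in grid (pickle j).+1.
Proof.
rewrite mem_grid mem_pmap; apply/mapP; exists (pickle j); last by rewrite pickleK.
by rewrite mem_iota add0n ltnS leqnn.
Qed.

Lemma sub_grid N N' : (N <= N')%N -> {subset grid N <= grid N'}.
Proof.
move=> NN j; rewrite !mem_grid !mem_pmap => /mapP[i]; rewrite mem_iota add0n => iN ->.
by apply: map_f; rewrite mem_iota add0n (leq_trans iN).
Qed.

(** The scale satisfies [2^k <= 1 / (3 l) < 2 * 2^k]: the first inequality is what [dyadic_cover]
    needs in each coordinate, the second bounds the side by [6 l]. *)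
Lemma cube_sub_cell (a : n.-tuple R) (l : R) : 0 < l -> exists e j,
  cube a l `<=` cell e j /\ 2 ^ (- j.1) <= 6 * l :> R.
Proof.
move=> l0; have l3 : 0 < 3 * l by rewrite mulr_gt0.
have [|k /andP[k1 k2]] := @dyadic_scale R (3 * l)^-1; first by rewrite invr_gt0.
have k0 : 0 < 2 ^ k :> R by exact: exprz_gt0.
have h : 3 * l * 2 ^ k <= 1 by rewrite -ler_pdivlMl// mulr1.
pose e := [tuple sval (cid (dyadic_cover (tnth a i) (ltW l0) h)) | i < n].
exists e, (k, [tuple dyadic (tnth e i) k (tnth a i) | i < n]); split => /=.
  move=> x xQ i; rewrite /= tnth_mktuple tnth_mktuple.
  case: cid => /= b -> //; have [-> ->] := xQ i.
  by [].
rewrite -invr_expz -(ler_pM2l k0) mulfV ?gt_eqF//.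
have : 3 * l * (3 * l)^-1 < 3 * l * (2 * 2 ^ k) by rewrite ltr_pM2l.
by rewrite mulfV ?gt_eqF//; lra.
Qed.

End grids.

(** * The maximal operator on weighted Lebesgue spaces *)

Section maximal_function.
Import numFieldNormedType.Exports.
Local Open Scope ereal_scope.
Variables (R : realType) (n : nat).
Local Notation mu := (@lebesgue R n).
Implicit Types (f g : euclid R n -> \bar R) (a : n.-tuple R) (l : R).

Lemma average_cube a l g : (0 <= l)%R ->
  average (cube a l) g = ((l ^+ n)^-1)%:E * \int[mu]_(y in cube a l) g y.
Proof. by move=> l0; rewrite /average lebesgue_cube. Qed.

Lemma average_ge0 (Q : set (euclid R n)) g : (forall x, 0 <= g x) -> 0 <= average Q g.
Proof.
move=> g0; rewrite mule_ge0 ?integral_ge0//.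
by rewrite lee_fin invr_ge0 fine_ge0// measure_ge0.
Qed.

Lemma maximal_ge0 f x : 0 <= maximal f x.
Proof.
apply: le_ereal_sup_tmp; exists (average (cube (x : n.-tuple R) 1) (fun y => `|f y|)).
  exists (cube (x : n.-tuple R) 1) => //; split; first by exists x, 1%R.
  by move=> i; rewrite lexx lerDl.
exact: average_ge0.
Qed.

Lemma cube_sub a a' l l' : (forall i, tnth a' i <= tnth a i)%R ->
  (forall i, tnth a i + l <= tnth a' i + l')%R -> cube a l `<=` cube a' l'.
Proof.
move=> h1 h2 x xQ i; have [x1 x2] := xQ i.
by rewrite (le_trans (h1 i))// (le_trans x2).
Qed.

(** A slightly larger cube with rational data contains the old one, and its average stays above [t]
    by continuity of [l^n]. Countably many cubes therefore suffice, which gives the measurability of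
    [maximal f]. *)
Lemma maximal_rational f x (t : R) : measurable_fun setT f -> t%:E < maximal f x ->
  exists (a : n.-tuple rat) (l : rat), (0 < ratr l :> R)%R /\
    cube (map_tuple ratr a) (ratr l) x /\
    t%:E < average (cube (map_tuple ratr a) (ratr l)) (fun y => `|f y|).
Proof.
move=> mf /ereal_sup_gt[_ [_ [[a [l [l0 ->]]] xQ] <-]].
rewrite average_cube ?ltW// => tQ.
have l0n : (0 < l ^+ n)%R by exact: exprn_gt0.
have [e [e0 he]] : exists e : R, (0 < e)%R /\ forall l', (l < l' < l + e)%R ->
    t%:E < ((l' ^+ n)^-1)%:E * \int[mu]_(y in cube a l) `|f y|.
  move: tQ; have : 0 <= \int[mu]_(y in cube a l) `|f y| by exact: integral_ge0.
  case: (\int[mu]_(y in cube a l) `|f y|) => [r r0|_ _|//]; last first.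
    exists 1%R; split=> // l' /andP[ll' _]; rewrite gt0_muley ?ltry// lte_fin invr_gt0.
    by apply: exprn_gt0; exact: lt_trans ll'.
  rewrite -EFinM lte_fin ltr_pdivlMl// => tr.
  have : \forall y \near l, (y ^+ n * t < r)%R.
    apply: (@cvgr_lt _ _ (nbhs l) _ (fun y : R => (y ^+ n * t)%R) (l ^+ n * t)%R) => //.
    by apply: cvgM; [exact: exprn_continuous|exact: cvg_cst].
  move=> [e /= e0 he]; exists e; split => // l' /andP[ll' le'].
  have l'0 : (0 < l' ^+ n)%R by apply: exprn_gt0; exact: lt_trans ll'.
  rewrite -EFinM lte_fin ltr_pdivlMl//; apply: he => /=.
  by rewrite /ball_ /= distrC ger0_norm; lra.
have ll : (l < l + e)%R by rewrite ltrDl.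
have [l' hl'] := rat_in_itvoo ll.
move: hl'; rewrite in_itv /= => hl'; have /andP[ll' le'] := hl'.
(* Any corner in this range makes a cube of side [l'] contain the old cube; the range is nonempty
   because [l < l']. *)
have ha i : exists q : rat, (tnth a i + l - ratr l' < ratr q < tnth a i)%R.
  have [|q] := @rat_in_itvoo _ (tnth a i + l - ratr l')%R (tnth a i); first by lra.
  by rewrite in_itv /= => hq; exists q.
pose a' := [tuple sval (cid (ha i)) | i < n].
have l'0 : (0 < ratr l' :> R)%R by exact: lt_trans ll'.
have sub : cube a l `<=` cube (map_tuple ratr a') (ratr l').
  apply: cube_sub => i; rewrite tnth_map tnth_mktuple; case: cid => q /= /andP[q1 q2].
    exact: ltW.
  by lra.
exists a', l'; split => //; split; first exact: sub.
rewrite average_cube ?ltW//; apply: (lt_le_trans (he _ hl')).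
apply: lee_wpmul2l; first by rewrite lee_fin invr_ge0 exprn_ge0// ltW.
apply: ge0_subset_integral; [exact: measurable_cube|exact: measurable_cube| | |exact: sub].
  exact: measurable_fun_abse.
by move=> y _; exact: abse_ge0.
Qed.

Lemma measurable_maximal f : measurable_fun setT f -> measurable_fun setT (maximal f).
Proof.
move=> mf; apply: (measurability _ (ErealGenOInfty.measurableE R)).
move=> /= _ [_ [t ->]] <-; apply: measurableI => //; rewrite preimage_itvoy.
pose C (i : nat) : set (euclid R n) := if unpickle i is Some al then
  let: (a, l) := al : (n.-tuple rat * rat)%type in
  if `[< (0 < ratr l :> R)%R /\
    t%:E < average (cube (map_tuple ratr a) (ratr l)) (fun y => `|f y|) >]
  then cube (map_tuple ratr a) (ratr l) else set0 else set0.
rewrite (_ : [set _ | _] = \bigcup_i C i); last first.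
  apply/seteqP; split=> x /=.
    move=> /(maximal_rational mf)[a [l [l0 [xQ tQ]]]].
    exists (pickle (a, l)) => //; rewrite /C pickleK.
    by case: asboolP => // -[].
  move=> [i _]; rewrite /C; case: unpickle => // -[a l].
  case: asboolP => // -[l0 tQ] xQ; apply: (lt_le_trans tQ).
  apply: ereal_sup_ubound; exists (cube (map_tuple ratr a) (ratr l)) => //.
  by split => //; exists (map_tuple ratr a), (ratr l).
apply: bigcup_measurable => i _; rewrite /C; case: unpickle => // -[a l].
by case: asboolP => // _; exact: measurable_cube.
Qed.

End maximal_function.

(** * Summation over the shifted grids, for weights that are positive everywhere *)

Section positive_weights.
Local Open Scope ereal_scope.
Variables (R : realType) (n : nat).
Local Notation mu := (@lebesgue R n).

(** A bound for [p]-th powers of norms: [6^n] bounds the volume of a cell relative to the cube it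
    covers, the cardinality counts the grids, and the rest is the constant of [lerner_refining]. *)
Definition buckley_cst (p A : R) : R :=
  (((6 ^+ n) `^ p * #|{: n.-tuple bool}|%:R) * (doob_cst (p / (p - 1)) * doob_cst p)
    * A `^ (p / (p - 1)))%R.

Variables (p A : R) (w f : euclid R n -> R).
Hypotheses (p1 : (1 < p)%R) (A0 : (0 < A)%R).
Hypotheses (w0 : forall x, (0 < w x)%R) (mw : measurable_fun setT w).
Hypotheses (f0 : forall x, (0 <= f x)%R) (mf : measurable_fun setT f).
Let sg x := (w x `^ (- (p - 1)^-1))%R.
Hypothesis wQ : forall a l, (0 < l)%R -> \int[mu]_(x in cube a l) (w x)%:E < +oo.
Hypothesis sgQ : forall a l, (0 < l)%R -> \int[mu]_(x in cube a l) (sg x)%:E < +oo.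
Hypothesis fQ : forall a l, (0 < l)%R -> \int[mu]_(x in cube a l) (f x)%:E < +oo.
Hypothesis ApQ : forall a l, (0 < l)%R ->
  (fine (\int[mu]_(x in cube a l) (w x)%:E) *
   fine (\int[mu]_(x in cube a l) (sg x)%:E) `^ (p - 1) <= A * (l ^+ n) `^ p)%R.

Let lower := (A `^ (p / (p - 1)) * doob_cst (p / (p - 1)) * doob_cst p)%R.

Let msg : measurable_fun setT sg. Proof. exact: measurable_fun_powRl. Qed.

Let cell_le (g : euclid R n -> R) e j a : (forall x, (0 <= g x)%R) ->
  measurable_fun setT g -> cell e j `<=` cube a (2 ^ (- j.1)) ->
  \int[mu]_(x in cell e j) (g x)%:E <= \int[mu]_(x in cube a (2 ^ (- j.1))) (g x)%:E.
Proof.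
move=> g0 mg sub; apply: ge0_subset_integral.
- exact: measurable_cell.
- exact: measurable_cube.
- by apply/measurable_EFinP; exact: measurable_funTS.
- by move=> x _; rewrite lee_fin.
- exact: sub.
Qed.

Let j0 (j : int * n.-tuple int) : (0 < 2 ^ (- j.1) :> R)%R.
Proof. exact: exprz_gt0. Qed.

Let cell_fin (g : euclid R n -> R) e j : (forall x, (0 <= g x)%R) ->
  measurable_fun setT g ->
  (forall a l, (0 < l)%R -> \int[mu]_(x in cube a l) (g x)%:E < +oo) ->
  \int[mu]_(x in cell e j) (g x)%:E < +oo.
Proof.
move=> g0 mg gQ; have [a sub] := cell_sub_cube R e j.
exact: le_lt_trans (cell_le g0 mg sub) (gQ _ _ (j0 j)).
Qed.

Let w0' x : (0 <= w x)%R. Proof. exact: ltW. Qed.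
Let sg0' x : (0 <= sg x)%R. Proof. exact: powR_ge0. Qed.

Let cell_Ap e j :
  (fine (\int[mu]_(x in cell e j) (w x)%:E) *
   fine (\int[mu]_(x in cell e j) (sg x)%:E) `^ (p - 1)
   <= A * fine (mu (cell e j)) `^ p)%R.
Proof.
have [a sub] := cell_sub_cube R e j.
rewrite lebesgue_cell /=; apply: le_trans (ApQ a (j0 j)).
have fin (g : euclid R n -> R) : (forall x, (0 <= g x)%R) ->
  measurable_fun setT g ->
  (forall a l, (0 < l)%R -> \int[mu]_(x in cube a l) (g x)%:E < +oo) ->
  (0 <= fine (\int[mu]_(x in cell e j) (g x)%:E) <=
    fine (\int[mu]_(x in cube a (2 ^ (- j.1))) (g x)%:E))%R.
  move=> g0 mg gQ; apply/andP; split.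
    by rewrite fine_ge0// integral_ge0// => x _; rewrite lee_fin.
  by apply: fine_le; [| |exact: cell_le];
    rewrite ge0_fin_numE ?gQ ?(cell_fin _ _ g0 mg gQ)// integral_ge0// => x _;
    rewrite lee_fin.
have /andP[h1 h2] := fin w w0' mw wQ.
have /andP[h3 h4] := fin sg sg0' msg sgQ.
apply: ler_pM; [exact: h1|exact: powR_ge0|exact: h2|].
apply: ge0_ler_powR; rewrite ?nnegrE; [|exact: h3|exact: le_trans h4|exact: h4].
by rewrite subr_ge0 ltW.
Qed.

Let G N e x := (max_over (cell e) (mean mu (cell e) f) (grid n N) x `^ p * w x)%R.

Let G0 N e x : (0 <= G N e x)%R. Proof. by rewrite mulr_ge0 ?powR_ge0. Qed.

Let mG N e : measurable_fun setT (G N e).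
Proof.
apply: measurable_funM; last exact: mw.
by apply: measurable_fun_powRl; apply: measurable_max_over => j; exact: measurable_cell.
Qed.

Let mean0 e j : (0 <= mean mu (cell e) f j)%R.
Proof.
rewrite /mean divr_ge0 ?fine_ge0// ?integral_ge0// => x _.
by rewrite lee_fin.
Qed.

Let ndG N N' e x : (N <= N')%N -> (G N e x <= G N' e x)%R.
Proof.
move=> NN; rewrite ler_wpM2r// ge0_ler_powR ?nnegrE ?max_over_ge0//.
  by move: p1; lra.
by apply: max_over_sub => //; exact: sub_grid.
Qed.

Let meanE e j : mean mu (cell e) f j =
  (fine (\int[mu]_(x in cell e j) (f x)%:E) / (2 ^ (- j.1)) ^+ n)%R.
Proof. by rewrite /mean; congr (_ / _)%R; exact: (congr1 fine (lebesgue_cell R e j)). Qed.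

Let mEf : measurable_fun setT (EFin \o f). Proof. exact/measurable_EFinP. Qed.

Let int_G N e : \int[mu]_x (G N e x)%:E <= lower%:E * \int[mu]_x (f x `^ p * w x)%:E.
Proof.
apply: (lerner_refining p1 A0 w0 mw f0 mf).
- by move=> j; exact: measurable_cell.
- exact: refining_grid.
- move=> j; have : 0 < mu (cell e j) < +oo by rewrite lebesgue_cell lte_fin exprn_gt0 ?ltry.
  exact.
- by move=> j; exact: (cell_fin _ _ w0' mw wQ).
- by move=> j; exact: (cell_fin _ _ sg0' msg sgQ).
- by move=> j; exact: (cell_fin _ _ f0 mf fQ).
- exact: cell_Ap.
Qed.

(** A sum over the grids in place of a maximum: integration is then termwise, at the price of a
    factor [2^n]. *)
Let H N x := (\sum_(e : n.-tuple bool) G N e x)%R.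

Let ndH x : {homo (fun N => (H N x)%:E) : N N' / (N <= N')%N >-> N <= N'}.
Proof. by move=> N N' NN; rewrite lee_fin; apply: ler_sum => e _; exact: ndG. Qed.

Let H0 N x : (0 <= H N x)%R. Proof. by apply: sumr_ge0. Qed.

Let mH N : measurable_fun setT (fun x => (H N x)%:E).
Proof. by apply/measurable_EFinP; apply: measurable_sum => e; exact: mG. Qed.

Let int_H N : \int[mu]_x (H N x)%:E <=
  (#|{: n.-tuple bool}|%:R * lower)%:E * \int[mu]_x (f x `^ p * w x)%:E.
Proof.
under eq_integral do rewrite /H -sumEFin.
rewrite (ge0_integral_sum _ measurableT); last 2 first.
- by move=> e; apply/measurable_EFinP; exact: mG.
- by move=> e x _; rewrite lee_fin.
apply: (@le_trans _ _ (\sum_(e : n.-tuple bool) (lower%:E * \int[mu]_x (f x `^ p * w x)%:E))).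
  by apply: lee_sum => e _; exact: int_G.
have low0 : (0 <= lower)%R.
  apply: mulr_ge0; last exact: doob_cst_ge0.
  apply: mulr_ge0; first exact: powR_ge0.
  by apply: doob_cst_ge0; rewrite ltr_pdivlMr ?subr_gt0//; lra.
rewrite -ge0_sume_distrl//.
by rewrite sumEFin sumr_const -[(lower *+ _)%R]mulr_natl.
Qed.

(** If the limit is a finite [r], then every cell containing [x] has mean at most [(r / w x)^(1/p)],
    since it occurs in [grid n N] for large [N]. A cube containing [x] has average at most [6^n]
    times the mean over a cell that covers it. *)
Let maximal_le_H x :
  maximal (EFin \o f) x `^ p * (w x)%:E <= ((6 ^+ n) `^ p)%:E * limn (fun N => (H N x)%:E).
Proof.
have p0 : (0 < p)%R by move: p1; lra.
have cv := ereal_nondecreasing_is_cvgn (@ndH x).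
have HL N : (H N x)%:E <= limn (fun N => (H N x)%:E).
  by apply: lime_ge => //; near=> m; apply: ndH; near: m; exists N.
have L0 : 0 <= limn (fun N => (H N x)%:E) by apply: le_trans (HL 0%N); rewrite lee_fin.
have c0 : (0 < (6 ^+ n) `^ p :> R)%R by rewrite powR_gt0// exprn_gt0.
move: HL L0; case: (limn _) => [r HL r0|_ _|//]; last first.
  by rewrite gt0_muley ?leey// lte_fin.
rewrite lee_fin in r0.
pose B := (6 ^+ n * (r / w x) `^ p^-1)%R.
have rw0 : (0 <= r / w x)%R by rewrite divr_ge0.
have maxB : maximal (EFin \o f) x <= B%:E.
  apply: ge_ereal_sup => _ [_ [[a [l [l0 ->]]] xQ] <-].
  have [e [j [sub jl]]] := cube_sub_cell a l0.
  have ln0 : (0 < l ^+ n)%R by exact: exprn_gt0.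
  rewrite average_cube ?(ltW l0)//.
  have cellE : \int[mu]_(y in cell e j) `|(EFin \o f) y| =
      (fine (\int[mu]_(y in cell e j) (f y)%:E))%:E.
    rewrite fineK; last first.
      by rewrite ge0_fin_numE ?(cell_fin _ _ f0 mf fQ)// integral_ge0// => y _; rewrite lee_fin.
    by apply: eq_integral => y _ /=; rewrite ger0_norm.
  apply: (@le_trans _ _ (((l ^+ n)^-1)%:E * \int[mu]_(y in cell e j) `|(EFin \o f) y|)).
    apply: lee_wpmul2l; first by rewrite lee_fin invr_ge0 ltW.
    apply: ge0_subset_integral; [exact: measurable_cube|exact: measurable_cell| | |exact: sub].
      by apply: measurable_fun_abse; exact: mEf.
    by move=> y _; exact: abse_ge0.
  rewrite cellE -EFinM lee_fin.
  set F := fine _; have F0 : (0 <= F)%R.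
    by rewrite fine_ge0// integral_ge0// => y _; rewrite lee_fin.
  have m0 : (0 < (2 ^ (- j.1)) ^+ n :> R)%R by exact: exprn_gt0.
  apply: (@le_trans _ _ (6 ^+ n * mean mu (cell e) f j)%R).
    rewrite meanE -/F mulrC mulrCA ler_wpM2l//.
    rewrite ler_pdivlMr// mulrC ler_pdivrMr// -exprMn.
    by apply: lerXn2r => //; rewrite nnegrE ?mulr_ge0 ?(ltW l0) ?(ltW (j0 j)).
  rewrite ler_wpM2l ?exprn_ge0//.
  have := HL (pickle j).+1; rewrite lee_fin => hG.
  have GH : (G (pickle j).+1 e x <= H (pickle j).+1 x)%R.
    rewrite /H (bigD1 e)//= lerDl; exact: sumr_ge0.
  have {hG GH} := le_trans GH hG; rewrite /G -ler_pdivlMr//.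
  have le1 := @le_max_over _ _ R _ (cell e) (mean mu (cell e) f) _ _ x (pickle_grid j) (sub _ xQ).
  set Mx := max_over _ _ _ _ in le1 *; have M0 : (0 <= Mx)%R by exact: le_trans le1.
  move=> h; apply: (le_trans le1).
  rewrite -[leLHS]powRr1// -(mulfV (lt0r_neq0 p0)) powRrM.
  by apply: ge0_ler_powR; rewrite ?nnegrE ?powR_ge0// invr_ge0 ltW.
apply: (@le_trans _ _ (B%:E `^ p * (w x)%:E)).
  apply: lee_wpmul2r; first by rewrite lee_fin.
  apply: gt0_ler_poweR; rewrite ?(ltW p0)// in_itv /= leey andbT ?maximal_ge0//.
  by apply: le_trans maxB; exact: maximal_ge0.
rewrite poweR_EFin -!EFinM lee_fin /B powRM ?powR_ge0 ?exprn_ge0//.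
rewrite -powRrM mulVf ?gt_eqF// powRr1// -mulrA divfK//.
by rewrite gt_eqF.
Unshelve. all: by end_near. Qed.

Lemma buckley_positive :
  \int[mu]_x (maximal (EFin \o f) x `^ p * (w x)%:E) <=
  (buckley_cst p A)%:E * \int[mu]_x (f x `^ p * w x)%:E.
Proof.
have c0 : (0 <= (6 ^+ n) `^ p :> R)%R by exact: powR_ge0.
have cv x := ereal_nondecreasing_is_cvgn (@ndH x).
have mL : measurable_fun setT (fun x => limn (fun N => (H N x)%:E)).
  apply: (@emeasurable_fun_cvg _ _ _ setT (fun N x => (H N x)%:E)) => [N|x _].
    exact: mH.
  exact: cv.
have L0 x : 0 <= limn (fun N => (H N x)%:E).
  by apply: lime_ge => //; apply: nearW => m; rewrite lee_fin.
apply: (@le_trans _ _ (\int[mu]_x (((6 ^+ n) `^ p)%:E * limn (fun N => (H N x)%:E)))).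
  apply: ge0_le_integral.
  - exact: measurableT.
  - by move=> x _; rewrite mule_ge0 ?poweR_ge0// lee_fin.
  - apply: emeasurable_funM; last exact/measurable_EFinP.
    apply: (measurableT_comp (measurable_poweR p)).
    exact: measurable_maximal mEf.
  - exact: measurable_funeM mL.
  - by move=> x _; exact: maximal_le_H.
rewrite (ge0_integralZl_EFin _ measurableT (fun x _ => L0 x) mL c0).
have -> : \int[mu]_x limn (fun N => (H N x)%:E) = limn (fun N => \int[mu]_x (H N x)%:E).
  have H0' N x : setT x -> 0 <= (H N x)%:E by rewrite lee_fin.
  have ndH' x : setT x -> {homo (fun N => (H N x)%:E) : N N' / (N <= N')%N >-> N <= N'}.
    by move=> _; exact: ndH.
  have := monotone_convergence mu measurableT mH H0' ndH'. exact.
apply: (@le_trans _ _ (((6 ^+ n) `^ p)%:E *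
   ((#|{: n.-tuple bool}|%:R * lower)%:E * \int[mu]_x (f x `^ p * w x)%:E))).
  apply: lee_wpmul2l; first by rewrite lee_fin.
  apply: lime_le; last by apply: nearW => N; exact: int_H.
  apply: ereal_nondecreasing_is_cvgn => N N' NN.
  apply: ge0_le_integral; [exact: measurableT| |exact: mH|exact: mH|].
    by move=> x _; rewrite lee_fin.
  by move=> x _; exact: ndH.
have -> : buckley_cst p A = ((6 ^+ n) `^ p * (#|{: n.-tuple bool}|%:R * lower))%R.
  rewrite /buckley_cst /lower; move: (doob_cst p) (doob_cst (p / (p - 1))) => D D'.
  by move: (_ `^ _)%R (_ `^ _)%R => c b; ring.
by rewrite (EFinM (_ `^ p)) muleA.
Qed.

End positive_weights.

(** * Null sets and the reduction to positive weights *)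

Section almost_everywhere.
Local Open Scope ereal_scope.
Context d (T : measurableType d) (R : realType).
Variable mu : {measure set T -> \bar R}.

Lemma ae_lty_integral (A : set T) (g : T -> \bar R) : measurable A ->
  (forall x, 0 <= g x) -> measurable_fun setT g -> \int[mu]_(x in A) g x < +oo ->
  {ae mu, forall x, A x -> g x < +oo}.
Proof.
move=> mA g0 mg gA; have : mu.-integrable A g.
  apply/integrableP; split; first exact: measurable_funTS.
  by under eq_integral => x _ do rewrite gee0_abs//.
move=> /(integrable_ae mA); apply: filterS => x h /h.
by rewrite ge0_fin_numE.
Qed.

Lemma ae_eq0_integral (A : set T) (w : T -> R) : measurable A ->
  (forall x, (0 <= w x)%R) -> measurable_fun setT w ->
  \int[mu]_(x in A) (w x)%:E = 0 -> {ae mu, forall x, A x -> w x = 0%R}.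
Proof.
move=> mA w0 mw wA.
have mw' : measurable_fun A (EFin \o w) by apply/measurable_EFinP; exact: measurable_funTS.
have : \int[mu]_(x in A) `|(EFin \o w) x| = 0.
  by rewrite -wA; apply: eq_integral => x _ /=; rewrite ger0_norm.
move/(ae_eq_integral_abs mu mA mw'); apply: filterS => x h /h /=.
by case.
Qed.

Lemma ae_cover (F : (set T)^nat) (P : T -> Prop) : (forall x, exists N, F N x) ->
  (forall N, {ae mu, forall x, F N x -> P x}) -> {ae mu, forall x, P x}.
Proof. by move=> cov /ae_foralln; apply: filterS => x h; have [N /h] := cov x. Qed.

Lemma measurable_weight_pow (w : T -> R) s : measurable_fun setT w ->
  measurable_fun setT (fun x => weight_pow (w x) s).
Proof.
move=> mw; apply: measurable_fun_ifT.
- by apply: measurable_and; [exact: measurable_fun_eqr|exact: measurable_cst].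
- exact: measurable_cst.
- by apply/measurable_EFinP; exact: measurable_fun_powRl.
Qed.

Lemma weight_pow_ge0 (u s : R) : 0 <= weight_pow u s.
Proof. by rewrite /weight_pow; case: ifP => // _; rewrite lee_fin powR_ge0. Qed.

Lemma ge0_ae_integral (A : set T) (f g : T -> \bar R) : measurable A ->
  measurable_fun setT f -> measurable_fun setT g ->
  (forall x, 0 <= f x) -> (forall x, 0 <= g x) -> {ae mu, forall x, f x = g x} ->
  \int[mu]_(x in A) f x = \int[mu]_(x in A) g x.
Proof.
move=> mA mf mg f0 g0 fg; apply: ge0_ae_eq_integral => //.
- exact: measurable_funTS.
- exact: measurable_funTS.
- by move: fg; apply: filterS => x.
Qed.

End almost_everywhere.

Lemma one_sub_conj_exp (R : realType) (p : R) : 1 < p ->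
  1 - conj_exp p = - (p - 1)^-1.
Proof.
move=> p1; have p1n0 : p - 1 != 0 by rewrite gt_eqF// subr_gt0.
have p0 : p != 0 by rewrite gt_eqF//; lra.
by rewrite /conj_exp; field; rewrite p0 p1n0.
Qed.

(** With [s = w^(-1/(p-1))] one has [s^(p-1) w = 1], so either [v <= s] or [v^(p-1) w >= 1]. This
    pointwise bound takes the place of Hölder's inequality in proving functions of [L^p(w)] locally
    integrable. *)
Lemma le_powR_weight (R : realType) (p v w : R) : 1 < p -> 0 <= v -> 0 < w ->
  v <= v `^ p * w + w `^ (- (p - 1)^-1).
Proof.
move=> p1 v0 w0; set s := w `^ _; have s0 : 0 < s by exact: powR_gt0.
have p0 : 0 < p by lra.
have [vs|sv] := leP v s; first by apply: ler_wpDl => //; rewrite mulr_ge0 ?powR_ge0// ltW.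
apply: ler_wpDr; first exact: ltW.
have vp0 : 0 < v by exact: lt_trans sv.
rewrite -(mulr_powRB1 v0 p0) -mulrA ler_peMr//.
have e : s `^ (p - 1) * w = 1.
  rewrite /s -powRrM mulNr mulVf ?gt_eqF ?subr_gt0// powR_inv1 ?ltW//.
  by rewrite mulVf// gt_eqF.
rewrite -[leLHS]e ler_pM2r//; apply: ge0_ler_powR; rewrite ?nnegrE ?(ltW s0) ?(ltW sv)//.
by rewrite subr_ge0 ltW.
Qed.

Section centered_cubes.
Variables (R : realType) (n : nat).

Definition centered (N : nat) : set (euclid R n) :=
  cube [tuple - (N.+1%:R) | i < n] (N.+1%:R *+ 2).

Lemma centered_cover (x : euclid R n) : exists N0, forall N, (N0 <= N)%N -> centered N x.
Proof.
exists (\max_(i < n) Num.bound `|tnth (x : n.-tuple R) i|)%N => N hN i.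
rewrite tnth_mktuple.
have : `|tnth (x : n.-tuple R) i| <= N.+1%:R.
  apply: (le_trans (ltW (archi_boundP (normr_ge0 _)))).
  rewrite ler_nat; apply: leq_trans (leqW hN).
  exact: (leq_bigmax i).
by rewrite ler_norml => /andP[h1 h2]; split; [|rewrite mulr2n; lra].
Qed.

End centered_cubes.

Section Ap_weights.
Local Open Scope ereal_scope.
Variables (R : realType) (n : nat).
Local Notation mu := (@lebesgue R n).
Variables (p : R) (w : euclid R n -> R).
Hypotheses (p1 : (1 < p)%R) (Apw : Ap p w).
Let dual x := weight_pow (w x) (1 - conj_exp p).

Let w0 x : (0 <= w x)%R. Proof. by have [[]] := Apw. Qed.
Let mw : measurable_fun setT w. Proof. by have [[]] := Apw. Qed.

Let p1' : (0 < p - 1)%R. Proof. by rewrite subr_gt0. Qed.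

Lemma Ap_weight_fin a l : (0 < l)%R -> \int[mu]_(x in cube a l) (w x)%:E < +oo.
Proof. by move=> l0; have [[_ _ h] _] := Apw; apply: h; exists a, l. Qed.

Lemma Ap_average a l : (0 < l)%R ->
  average (cube a l) (fun x => (w x)%:E) * average (cube a l) dual `^ (p - 1)
    <= Ap_const p w.
Proof. by move=> l0; apply: ereal_sup_ubound; exists (cube a l) => //; exists a, l. Qed.

Lemma Ap_const_ge0 : 0 <= Ap_const p w.
Proof.
apply: le_trans (@Ap_average [tuple 0%R | i < n] 1%R ltr01).
by apply: mule_ge0; [apply: average_ge0 => x; rewrite lee_fin|exact: poweR_ge0].
Qed.

Lemma Ap_constE : Ap_const p w = (fine (Ap_const p w))%:E.
Proof. by rewrite fineK// ge0_fin_numE ?Ap_const_ge0//; have [] := Apw. Qed.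

(** A positive average of [w] times an infinite dual average would make the A_p constant
    infinite. *)
Lemma Ap_dual_fin a l : (0 < l)%R -> 0 < \int[mu]_(x in cube a l) (w x)%:E ->
  \int[mu]_(x in cube a l) dual x < +oo.
Proof.
move=> l0 w_gt0; rewrite ltey; apply/eqP => h.
have ln0 : 0 < ((l ^+ n)^-1)%:E by rewrite lte_fin invr_gt0 exprn_gt0.
have := Ap_average a l0; have [_] := Apw.
rewrite !average_cube ?(ltW l0)// h gt0_muley// poweRyr ?gt_eqF// gt0_muley ?mule_gt0//.
by move=> /lt_geF ->.
Qed.

(** The dual weight is [+oo] where [w] vanishes. Once [w] has mass on one cube, the dual weight is
    integrable on all larger cubes, so [w] is positive almost everywhere. The zero weight is a
    genuine case: [0 * +oo = 0] puts it in A_p. *)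
Lemma Ap_ae_dichotomy :
  {ae mu, forall x, w x = 0%R} \/ {ae mu, forall x, (0 < w x)%R}.
Proof.
have mc N : measurable (@centered R n N) by exact: measurable_cube.
have [h|/existsNP[N0 hN0]] :=
    pselect (forall N, \int[mu]_(x in @centered R n N) (w x)%:E = 0).
  left; apply: (ae_cover (F := @centered R n)) => [x|N].
    by have [N hN] := centered_cover x; exists N; exact: hN.
  exact: (ae_eq0_integral (mc N) w0 mw (h N)).
right; apply: (ae_cover (F := fun N => @centered R n (maxn N N0))) => [x|N].
  by have [N hN] := centered_cover x; exists N; apply: hN; exact: leq_maxl.
have mfw : measurable_fun (@centered R n (maxn N N0)) (EFin \o w).
  by apply/measurable_EFinP; exact: measurable_funTS.
have wN : 0 < \int[mu]_(x in @centered R n (maxn N N0)) (w x)%:E.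
  apply: (@lt_le_trans _ _ (\int[mu]_(x in @centered R n N0) (w x)%:E)).
    rewrite lt0e integral_ge0 ?andbT; first exact/eqP.
    by move=> x _; rewrite lee_fin.
  apply: ge0_subset_integral; [exact: mc|exact: mc|exact: mfw| |].
    by move=> x _; rewrite lee_fin.
  have le : (N0.+1%:R <= (maxn N N0).+1%:R :> R)%R by rewrite ler_nat ltnS leq_maxr.
  by apply: cube_sub => i; rewrite !tnth_mktuple; rewrite ?mulr2n; lra.
have l0 : (0 < (maxn N N0).+1%:R *+ 2 :> R)%R by rewrite mulrn_wgt0.
have mdual : measurable_fun setT dual by exact: measurable_weight_pow.
have := ae_lty_integral (mc (maxn N N0)) (fun x => weight_pow_ge0 _ _) mdual (Ap_dual_fin l0 wN).
apply: filterS => x h /h; rewrite /dual /weight_pow.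
have [->|wx _] := eqVneq (w x) 0%R; last by rewrite lt0r wx w0.
by rewrite one_sub_conj_exp// oppr_lt0 invr_gt0 p1' /= ltxx.
Qed.

End Ap_weights.

(** * The norm bound for general A_p weights and for the iterates *)

Section maximal_bound.
Local Open Scope ereal_scope.
Variables (R : realType) (n : nat).
Local Notation mu := (@lebesgue R n).
Implicit Types (p : R) (w : euclid R n -> R) (f : euclid R n -> \bar R).

Lemma measurable_wnorm_integrand p w f : measurable_fun setT w ->
  measurable_fun setT f -> measurable_fun setT (fun x => `|f x| `^ p * (w x)%:E).
Proof.
move=> mw mf; apply: emeasurable_funM; last exact/measurable_EFinP.
by apply: (measurableT_comp (measurable_poweR p)); exact: measurable_fun_abse.
Qed.

Lemma wnorm_integrand_ge0 p w f x : (0 <= w x)%R -> 0 <= `|f x| `^ p * (w x)%:E.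
Proof. by move=> w0; rewrite mule_ge0 ?poweR_ge0// lee_fin. Qed.

Lemma wnorm_weight0 p w f : (1 < p)%R -> (forall x, (0 <= w x)%R) ->
  measurable_fun setT w -> measurable_fun setT f -> {ae mu, forall x, w x = 0%R} ->
  wnorm p w f = 0.
Proof.
move=> p1 w0 mw mf wae; rewrite /wnorm.
rewrite (@ge0_ae_integral _ _ _ mu setT _ (cst 0)).
- by rewrite integral0 poweR0r// invr_eq0 gt_eqF// (lt_trans _ p1).
- exact: measurableT.
- exact: measurable_wnorm_integrand.
- exact: measurable_cst.
- by move=> x; exact: wnorm_integrand_ge0.
- by [].
- by move: wae; apply: filterS => x ->; rewrite mule0.
Qed.

Lemma wnorm_lty p w f : (1 < p)%R ->
  wnorm p w f < +oo -> \int[mu]_x (`|f x| `^ p * (w x)%:E) < +oo.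
Proof. by move=> p1; apply: lty_poweRy; rewrite invr_eq0 gt_eqF// (lt_trans _ p1). Qed.

(** The constant at [A = 1]; the dependence on [A] factors out as [(A^p')^(1/p) = A^(1/(p-1))]. *)
Definition maximal_cst p : R := (buckley_cst n p 1 `^ p^-1)%R.

Lemma buckley_cst_ge0 p A : (1 < p)%R -> (0 <= A)%R -> (0 <= buckley_cst n p A)%R.
Proof.
move=> p1 A0; apply: mulr_ge0; last exact: powR_ge0.
apply: mulr_ge0; first by rewrite mulr_ge0 ?powR_ge0.
apply: mulr_ge0; last exact: doob_cst_ge0.
by apply: doob_cst_ge0; rewrite ltr_pdivlMr ?subr_gt0//; lra.
Qed.

Section positive_ae.
Variables (p : R) (w : euclid R n -> R) (f : euclid R n -> \bar R).
Hypotheses (p1 : (1 < p)%R) (Apw : Ap p w) (wae : {ae mu, forall x, (0 < w x)%R}).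
Hypotheses (mf : measurable_fun setT f) (Lf : wnorm p w f < +oo).

Let w0 x : (0 <= w x)%R. Proof. by have [[]] := Apw. Qed.
Let mw : measurable_fun setT w. Proof. by have [[]] := Apw. Qed.
Let p0 : (0 < p)%R. Proof. exact: lt_trans p1. Qed.

(** Changing [w] on its zero set, a null set here, makes division possible everywhere and alters no
    integral. *)
Let w' x := (if w x == 0 then 1 else w x)%R.
Let f' x := fine `|f x|.
Let sg x := (w' x `^ (- (p - 1)^-1))%R.
Let A := fine (Ap_const p w).

Let w'0 x : (0 < w' x)%R.
Proof. by rewrite /w'; case: eqVneq => // h; rewrite lt0r h w0. Qed.

Let mw' : measurable_fun setT w'.
Proof.
by apply: measurable_fun_ifT; [exact: measurable_fun_eqr|exact: measurable_cst|exact: mw].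
Qed.

Let w'E : {ae mu, forall x, w' x = w x}.
Proof. by move: wae; apply: filterS => x wx; rewrite /w' gt_eqF. Qed.

Let msg : measurable_fun setT sg. Proof. exact: measurable_fun_powRl. Qed.

Let f'0 x : (0 <= f' x)%R. Proof. exact: fine_ge0. Qed.

Let mf' : measurable_fun setT f'.
Proof.
apply: (measurableT_comp (@fine_measurable R setT measurableT)).
exact: measurable_fun_abse.
Qed.

(** [|f|^p w] has a finite integral, hence is finite almost everywhere; as [w] is positive almost
    everywhere, [f] is infinite only on a null set. *)
Let f'E : {ae mu, forall x, (f' x)%:E = `|f x|}.
Proof.
have := ae_lty_integral measurableT (fun x => wnorm_integrand_ge0 p f (w0 x))
  (measurable_wnorm_integrand p mw mf) (wnorm_lty p1 Lf).
move: wae; apply: filterS2 => x wx /(_ I) h; rewrite /f' fineK//.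
rewrite ge0_fin_numE//; apply: contraTT h; rewrite -!leNgt leye_eq => /eqP ->.
by rewrite poweRyr ?gt_eqF// gt0_mulye ?leey// lte_fin.
Qed.

Let w'Q a l : (0 < l)%R ->
  \int[mu]_(x in cube a l) (w' x)%:E = \int[mu]_(x in cube a l) (w x)%:E.
Proof.
move=> l0; apply: ge0_ae_integral; [exact: measurable_cube| | | | |].
- exact/measurable_EFinP.
- exact/measurable_EFinP.
- by move=> x; rewrite lee_fin ltW.
- by move=> x; rewrite lee_fin.
- by move: w'E; apply: filterS => x ->.
Qed.

Let sgE a l : (0 < l)%R -> \int[mu]_(x in cube a l) (sg x)%:E =
  \int[mu]_(x in cube a l) weight_pow (w x) (1 - conj_exp p).
Proof.
move=> l0; apply: ge0_ae_integral; [exact: measurable_cube| | | | |].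
- exact/measurable_EFinP.
- exact: measurable_weight_pow.
- by move=> x; rewrite lee_fin powR_ge0.
- by move=> x; exact: weight_pow_ge0.
- move: wae; apply: filterS => x wx.
  by rewrite /sg /w' /weight_pow gt_eqF//= one_sub_conj_exp.
Qed.

Let mu_cube_gt0 a l : (0 < l)%R -> 0 < mu (cube a l).
Proof. by move=> l0; rewrite lebesgue_cube ?(ltW l0)// lte_fin exprn_gt0. Qed.

Let w'Q_gt0 a l : (0 < l)%R -> 0 < \int[mu]_(x in cube a l) (w' x)%:E.
Proof.
move=> l0; apply: integral_gt0 => //; first exact: measurable_cube.
exact: mu_cube_gt0.
Qed.

Let w'Q_fin a l : (0 < l)%R -> \int[mu]_(x in cube a l) (w' x)%:E < +oo.
Proof. by move=> l0; rewrite w'Q//; exact: (Ap_weight_fin Apw). Qed.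

Let sgQ_fin a l : (0 < l)%R -> \int[mu]_(x in cube a l) (sg x)%:E < +oo.
Proof.
move=> l0; rewrite sgE//; apply: (Ap_dual_fin p1 Apw l0).
by rewrite -w'Q//; exact: w'Q_gt0.
Qed.

Let sgQ_gt0 a l : (0 < l)%R -> 0 < \int[mu]_(x in cube a l) (sg x)%:E.
Proof.
move=> l0; apply: integral_gt0 => //; first exact: measurable_cube.
  by move=> x; exact: powR_gt0.
exact: mu_cube_gt0.
Qed.

Let ApQ a l : (0 < l)%R ->
  (fine (\int[mu]_(x in cube a l) (w' x)%:E) *
   fine (\int[mu]_(x in cube a l) (sg x)%:E) `^ (p - 1) <= A * (l ^+ n) `^ p)%R.
Proof.
move=> l0; have := Ap_average p w a l0; rewrite !average_cube ?(ltW l0)//.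
rewrite -w'Q// -sgE// (Ap_constE Apw) -/A.
have fin (x : \bar R) : 0 < x -> x < +oo -> x = (fine x)%:E.
  by move=> x0 xoo; apply/esym/fineK; rewrite ge0_fin_numE// ltW.
rewrite (fin _ (w'Q_gt0 a l0) (w'Q_fin a l0)) (fin _ (sgQ_gt0 a l0) (sgQ_fin a l0)).
set W := fine _; set S := fine _.
have S0 : (0 <= S)%R by apply: fine_ge0; apply: ltW; exact: sgQ_gt0.
have ln0 : (0 < l ^+ n)%R by exact: exprn_gt0.
rewrite -!EFinM lee_fin /= powRM ?invr_ge0 ?(ltW ln0)//.
have -> : ((l ^+ n)^-1 `^ (p - 1) = ((l ^+ n) `^ (p - 1))^-1)%R.
  by rewrite -(powR_inv1 (ltW ln0)) -powRrM mulN1r powRN.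
rewrite -(mulr_powRB1 (ltW ln0) p0).
set Y := ((l ^+ n) `^ (p - 1))%R; set L := (l ^+ n)%R in ln0 *; set Z := (S `^ (p - 1))%R.
have Y0 : (0 < Y)%R by exact: powR_gt0.
have -> : (L^-1 * W * (Y^-1 * Z) = (W * Z) / (L * Y))%R.
  by field; rewrite !gt_eqF.
by rewrite ler_pdivrMr// mulr_gt0.
Qed.

Let A_gt0 : (0 < A)%R.
Proof.
have := @ApQ [tuple 0%R | i < n] 1%R ltr01; rewrite expr1n powR1 mulr1.
apply: lt_le_trans; apply: mulr_gt0.
  by apply: fine_gt0; rewrite w'Q_gt0 ?w'Q_fin.
by apply: powR_gt0; apply: fine_gt0; rewrite sgQ_gt0 ?sgQ_fin.
Qed.

Let norm_f : \int[mu]_x (`|f x| `^ p * (w x)%:E) = \int[mu]_x (f' x `^ p * w' x)%:E.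
Proof.
apply: ge0_ae_integral.
- exact: measurableT.
- exact: measurable_wnorm_integrand.
- by apply/measurable_EFinP/measurable_funM; [exact: measurable_fun_powRl|exact: mw'].
- by move=> x; exact: wnorm_integrand_ge0.
- by move=> x; rewrite lee_fin mulr_ge0 ?powR_ge0// ltW.
- by move: f'E w'E; apply: filterS2 => x <- ->; rewrite EFinM.
Qed.

Let f'Q a l : (0 < l)%R -> \int[mu]_(x in cube a l) (f' x)%:E < +oo.
Proof.
move=> l0; have mfw : measurable_fun setT (fun x => f' x `^ p * w' x)%R.
  by apply: measurable_funM; [exact: measurable_fun_powRl|exact: mw'].
have fw0 x : (0 <= f' x `^ p * w' x)%R by rewrite mulr_ge0 ?powR_ge0// ltW.
have sg0 x : (0 <= sg x)%R by exact: powR_ge0.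
have mQ := measurable_cube a l.
apply: (@le_lt_trans _ _ (\int[mu]_(x in cube a l)
    ((f' x `^ p * w' x)%:E + (sg x)%:E))).
  apply: ge0_le_integral; [exact: mQ| | | |].
  - by move=> x _; rewrite lee_fin.
  - by apply/measurable_EFinP; exact: measurable_funTS.
  - by apply/measurable_EFinP; apply: measurable_funTS; exact: measurable_funD.
  - by move=> x _; rewrite -EFinD lee_fin; exact: le_powR_weight.
rewrite ge0_integralD; last 5 first.
- exact: mQ.
- by move=> x _; rewrite lee_fin.
- by apply/measurable_EFinP; exact: measurable_funTS.
- by move=> x _; rewrite lee_fin.
- by apply/measurable_EFinP; exact: measurable_funTS.
apply: lte_add_pinfty; last exact: sgQ_fin.
apply: le_lt_trans (wnorm_lty p1 Lf); rewrite norm_f.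
apply: ge0_subset_integral; [exact: mQ|exact: measurableT| | |exact: subsetT].
  exact/measurable_EFinP.
by move=> x _; rewrite lee_fin.
Qed.

(** The equality holds at every point, because the maximal function sees [f] only through integrals
    over cubes. *)
Let maximalE : maximal f = maximal (EFin \o f').
Proof.
apply/funext => x; rewrite /maximal; congr ereal_sup.
have e Q : is_cube Q -> average Q (fun y => `|f y|) = average Q (fun y => `|(EFin \o f') y|).
  move=> [a [l [l0 ->]]]; rewrite /average; congr (_ * _).
  apply: ge0_ae_integral; [exact: measurable_cube| | | | |].
  - exact: measurable_fun_abse.
  - by apply: measurable_fun_abse; exact/measurable_EFinP.
  - by move=> y; exact: abse_ge0.
  - by move=> y; exact: abse_ge0.
  - by move: f'E; apply: filterS => y fy; rewrite [RHS]/= ger0_norm.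
apply/seteqP; split => _ [Q [cQ Qx] <-]; exists Q => //; rewrite ?e//.
Qed.

Lemma maximal_wnorm_pos :
  wnorm p w (maximal f) <= (maximal_cst p * A `^ (p - 1)^-1)%:E * wnorm p w f.
Proof.
rewrite /wnorm norm_f maximalE.
have -> : \int[mu]_x (`|maximal (EFin \o f') x| `^ p * (w x)%:E) =
    \int[mu]_x (maximal (EFin \o f') x `^ p * (w' x)%:E).
  have mM : measurable_fun setT (maximal (EFin \o f')).
    by apply: measurable_maximal; exact/measurable_EFinP.
  apply: ge0_ae_integral; [exact: measurableT| | | | |].
  - exact: measurable_wnorm_integrand.
  - apply: emeasurable_funM; last exact/measurable_EFinP.
    exact: (measurableT_comp (measurable_poweR p)) mM.
  - by move=> x; exact: wnorm_integrand_ge0.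
  - by move=> x; rewrite mule_ge0 ?poweR_ge0// lee_fin ltW.
  - by move: w'E; apply: filterS => x ->; rewrite gee0_abs// maximal_ge0.
have B0 := buckley_cst_ge0 p1 (ltW A_gt0).
have I0 : 0 <= \int[mu]_x (f' x `^ p * w' x)%:E.
  by apply: integral_ge0 => x _; rewrite lee_fin mulr_ge0 ?powR_ge0// ltW.
have h := buckley_positive p1 A_gt0 w'0 mw' f'0 mf' w'Q_fin sgQ_fin f'Q ApQ.
apply: (@le_trans _ _ (((buckley_cst n p A)%:E * \int[mu]_x (f' x `^ p * w' x)%:E) `^ p^-1)).
  have L0 : 0 <= \int[mu]_x (maximal (EFin \o f') x `^ p * (w' x)%:E).
    by apply: integral_ge0 => x _; rewrite mule_ge0 ?poweR_ge0// lee_fin ltW.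
  apply: gt0_ler_poweR; rewrite ?invr_ge0 ?(ltW p0)// in_itv /= leey andbT//.
  exact: le_trans h.
rewrite poweRM// ?lee_fin// poweR_EFin.
have -> : (buckley_cst n p A `^ p^-1 = maximal_cst p * A `^ (p - 1)^-1)%R.
  have -> : (buckley_cst n p A = buckley_cst n p 1 * A `^ (p / (p - 1)))%R.
    by rewrite /buckley_cst powR1 mulr1.
  rewrite powRM ?powR_ge0 ?buckley_cst_ge0// -powRrM; congr (_ * _ `^ _)%R.
  have p1n0 : (p - 1 != 0)%R by rewrite gt_eqF// subr_gt0.
  have pn0 : (p != 0)%R by rewrite gt_eqF.
  by field; rewrite pn0 p1n0.
by [].
Qed.

End positive_ae.

Lemma maximal_wnorm p w f : (1 < p)%R -> Ap p w ->
  measurable_fun setT f -> wnorm p w f < +oo ->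
  wnorm p w (maximal f) <=
    (maximal_cst p * fine (Ap_const p w) `^ (p - 1)^-1)%:E * wnorm p w f.
Proof.
move=> p1 Apw mf Lf; have [[w0 mw _] _] := Apw.
have [wae|wae] := Ap_ae_dichotomy p1 Apw; last exact: maximal_wnorm_pos.
rewrite (wnorm_weight0 p1 w0 mw (measurable_maximal mf) wae).
by apply: mule_ge0; [rewrite lee_fin mulr_ge0 ?powR_ge0|exact: poweR_ge0].
Qed.

Lemma iter_maximal_wnorm p w f k : (1 < p)%R -> Ap p w -> in_Lp p w f ->
  measurable_fun setT (iter k (@maximal R n) f) /\
  wnorm p w (iter k (@maximal R n) f) <=
    ((maximal_cst p * fine (Ap_const p w) `^ (p - 1)^-1) ^+ k)%:E * wnorm p w f.
Proof.
move=> p1 Apw [mf Lf]; set C := (_ * _)%R.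
have C0 : (0 <= C)%R by rewrite mulr_ge0 ?powR_ge0.
elim: k => [|k [mk Lk]]; first by rewrite expr0 mul1e.
split; first exact: measurable_maximal.
have Lk' : wnorm p w (iter k (@maximal R n) f) < +oo.
  apply: le_lt_trans Lk _; apply: lte_mul_pinfty => //.
  by rewrite lee_fin exprn_ge0.
apply: le_trans (maximal_wnorm p1 Apw mk Lk') _.
have -> : (C ^+ k.+1)%:E = C%:E * (C ^+ k)%:E by rewrite exprS EFinM.
by rewrite -muleA; apply: lee_wpmul2l; [rewrite lee_fin|exact: Lk].
Qed.

Lemma opnorm_iter_maximal_le p w k : (1 < p)%R -> Ap p w ->
  opnorm p w (iter k (@maximal R n)) <=
    (maximal_cst p ^+ k)%:E * Ap_const p w `^ (k%:R / (p - 1)).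
Proof.
move=> p1 Apw; apply: ereal_inf_lbound.
have e : ((maximal_cst p * fine (Ap_const p w) `^ (p - 1)^-1) ^+ k =
    maximal_cst p ^+ k * fine (Ap_const p w) `^ (k%:R / (p - 1)))%R.
  rewrite exprMn; congr (_ * _)%R.
  by rewrite -powR_mulrn ?powR_ge0// -powRrM mulrC.
exists ((maximal_cst p * fine (Ap_const p w) `^ (p - 1)^-1) ^+ k)%R; last first.
  by rewrite e EFinM -poweR_EFin -(Ap_constE Apw).
split; first by rewrite exprn_ge0// mulr_ge0 ?powR_ge0.
by move=> f Lf; have [] := iter_maximal_wnorm k p1 Apw Lf.
Qed.

End maximal_bound.

(** * Sharpness: power weights *)

Section pushforward_on.
Local Open Scope ereal_scope.
Context d1 d2 (X : measurableType d1) (Y : measurableType d2) (R : realType).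
Variables (mu : {measure set X -> \bar R}) (nu : {measure set Y -> \bar R}).
Variables (phi : X -> Y) (Q : set X) (I : set Y) (k : R).
Hypotheses (mphi : measurable_fun setT phi) (mQ : measurable Q) (mI : measurable I).
Hypotheses (QI : Q `<=` phi @^-1` I) (k0 : (0 <= k)%R).
Hypothesis muQ : forall A, measurable A -> A `<=` I ->
  mu (phi @^-1` A `&` Q) = k%:E * nu A.

(** On [I], the image under [phi] of [mu] restricted to [Q] is [k nu]. This serves for the
    projection of a cube to its first coordinate and for the reflection [t -> -t]. *)
Lemma integral_comp_on (h : Y -> \bar R) : measurable_fun setT h ->
  (forall y, 0 <= h y) ->
  \int[mu]_(x in Q) h (phi x) = k%:E * \int[nu]_(y in I) h y.
Proof.
move=> mh h0; have mhI : measurable_fun I h by exact: measurable_funTS.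
have mphiI : measurable (phi @^-1` I) by rewrite -[X in measurable X]setTI; exact: mphi.
have -> : \int[mu]_(x in Q) h (phi x) = \int[mrestr mu mQ]_(x in Q) h (phi x).
  by apply: eq_measure_integral => A mA AQ; rewrite /= /mrestr setIidl.
have -> : k%:E * \int[nu]_(y in I) h y = \int[mscale (NngNum k0) nu]_(y in I) h y.
  by rewrite ge0_integral_mscale.
have -> : \int[mscale (NngNum k0) nu]_(y in I) h y =
    \int[pushforward (mrestr mu mQ) phi]_(y in I) h y.
  by apply: eq_measure_integral => A mA AI; exact: esym (muQ mA AI).
rewrite ge0_integral_pushforward//.
rewrite [RHS](@ge0_negligible_integral _ _ _ _ (phi @^-1` I) (~` Q))//.
- by congr integral; rewrite setDE setCK setIidr.
- exact: measurableC.
- by apply: measurable_funTS; exact: measurableT_comp.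
- by move=> x _; exact: h0.
- exact: (etrans (congr1 mu (setICl Q)) (measure0 mu)).
Qed.

End pushforward_on.

(** * One-dimensional integrals of powers *)

Section integral_powR.
Import numFieldNormedType.Exports.
Local Open Scope ereal_scope.
Variables (R : realType) (d : R).
Hypothesis d0 : (0 < d)%R.
Local Notation lambda := (@lebesgue_measure R).
Implicit Types e m : R.

Lemma integral_powR_away e m : (0 < e < m)%R ->
  \int[lambda]_(t in `[e, m]) (t `^ (d - 1))%:E = ((m `^ d - e `^ d) / d)%:E.
Proof.
move=> /andP[e0 em].
pose F : R -> R := (d^-1 \*: (@powR R ^~ d : R -> R^o))%R.
have dF (t : R) : (0 < t)%R -> is_derive t 1%R F (t `^ (d - 1))%R.
  move=> t0; have h := is_derive1_powR d t0.
  apply: is_derive_eq; rewrite /GRing.scale /= mulrA mulVf ?mul1r//.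
  by rewrite gt_eqF.
rewrite (@continuous_FTC2 R _ F e m em).
- by rewrite -EFinB -mulrBr mulrC.
- apply: derivable_within_continuous => t; rewrite in_itv /= => /andP[et _].
  by apply: derivable_powR; rewrite in_itv /= andbT (lt_le_trans e0).
- have cF (t : R) : (0 < t)%R -> {for t, continuous F}.
    move=> t0; apply: differentiable_continuous; apply/derivable1_diffP.
    by have [] := dF t t0.
  split.
  + move=> t; rewrite in_itv /= => /andP[et _].
    by have [] := dF t (lt_trans e0 et).
  + exact: cvg_at_right_filter (cF e e0).
  + exact: cvg_at_left_filter (cF m (lt_trans e0 em)).
- move=> t; rewrite in_itv /= => /andP[et _].
  by rewrite derive1E; have [_ ->] := dF t (lt_trans e0 et).
Qed.

Let mf : measurable_fun setT (fun t : measurableTypeR R => (t `^ (d - 1))%:E).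
Proof. by apply/measurable_EFinP; exact: measurable_fun_powRl. Qed.

Lemma integral_powR_le m : (0 < m)%R ->
  \int[lambda]_(t in `[0%R, m]) (t `^ (d - 1))%:E <= (m `^ d / d)%:E.
Proof.
move=> m0; rewrite -integral_itv_obnd_cbnd; last exact: measurable_funTS.
(* The denominators start at 2 so that the left end is strictly below [m], as [integral_powR_away]
   requires. *)
have -> : `]0%R, m]%classic = \bigcup_N `[(m / N.+2%:R)%R, m]%classic.
  apply/seteqP; split=> t /=; rewrite in_itv /=.
    move=> /andP[t0 tm]; have := archi_boundP (divr_ge0 (ltW m0) (ltW t0)).
    set N := Num.bound _ => hN; exists N => //=; rewrite in_itv /= tm andbT.
    rewrite ler_pdivrMr// mulrC -ler_pdivrMr//.
    by apply: (le_trans (ltW hN)); rewrite ler_nat -addn2 leq_addr.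
  move=> [N _]; rewrite /= in_itv /= => /andP[h ->]; rewrite andbT.
  by apply: lt_le_trans h; rewrite divr_gt0.
have nd : nondecreasing_seq (fun N => `[(m / N.+2%:R)%R, m]%classic).
  move=> N N' NN; apply/subsetPset; apply: subset_itvr; rewrite bnd_simp.
  by rewrite ler_pM2l// lef_pV2 ?posrE// ler_nat !ltnS.
have f0 N t : `[(m / N.+2%:R)%R, m]%classic t -> 0 <= (t `^ (d - 1))%:E.
  by rewrite lee_fin powR_ge0.
have mF N : measurable (`[(m / N.+2%:R)%R, m]%classic : set (measurableTypeR R)).
  exact: measurable_itv.
have cv := @ge0_nondecreasing_set_cvg_integral _ (measurableTypeR R) R
  (fun N => `[(m / N.+2%:R)%R, m]%classic) (fun t => (t `^ (d - 1))%:E) lambda nd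
  mF (fun N => measurable_funTS mf) f0.
rewrite -(cvg_lim _ cv)//; apply: lime_le; first by apply/cvg_ex; eexists; exact: cv.
apply: nearW => N; rewrite integral_powR_away; last first.
  by rewrite divr_gt0//= ltr_pdivrMr// ltr_pMr// ltr1n.
by rewrite lee_fin ler_wpM2r ?invr_ge0 ?(ltW d0)// lerBlDr lerDl powR_ge0.
Qed.

Lemma integral_powR_ge m : (0 < m)%R ->
  (m `^ d / (2 * d))%:E <= \int[lambda]_(t in `[0%R, m]) (t `^ (d - 1))%:E.
Proof.
(* Chosen so that [e^d = m^d / 2]: the part of the integral over [[e, m]] is already half of
   [m^d / d]. *)
move=> m0; pose e := (m * 2 `^ (- d^-1))%R.
have e0 : (0 < e)%R by rewrite mulr_gt0// powR_gt0.
have em : (e < m)%R.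
  rewrite gtr_pMr// powRN invf_lt1 ?powR_gt0//.
  have : (1 `^ d^-1 < 2 `^ d^-1 :> R)%R.
    by apply: gt0_ltr_powR; rewrite ?nnegrE ?invr_gt0 ?ltr1n.
  by rewrite powR1.
have eE : (e `^ d = m `^ d / 2)%R.
  rewrite /e powRM ?powR_ge0 ?(ltW m0)// -powRrM mulNr mulVf ?gt_eqF//.
  by rewrite powR_inv1.
apply: (@le_trans _ _ (\int[lambda]_(t in `[e, m]) (t `^ (d - 1))%:E)).
  rewrite integral_powR_away ?e0// eE lee_fin.
  by rewrite le_eqVlt; apply/orP; left; apply/eqP; field; rewrite gt_eqF.
apply: ge0_subset_integral => //.
- exact: measurable_funTS.
- by move=> t _; rewrite lee_fin powR_ge0.
- by apply: subset_itvr; rewrite bnd_simp ltW.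
Qed.

End integral_powR.

Lemma lebesgue_measure_segment (R : realType) (a l : R) : 0 <= l ->
  lebesgue_measure `[a, a + l]%classic = l%:E.
Proof.
move=> l0; rewrite lebesgue_measure_itv /= lte_fin ltrDl.
case: ltP => [_|l0']; first by rewrite -EFinB addrAC subrr add0r.
by have -> : l = 0 by apply/le_anti; rewrite l0 l0'.
Qed.

Section singular_power.
Local Open Scope ereal_scope.
Variables (R : realType) (d : R).
Hypotheses (d0 : (0 < d)%R) (d1 : (d < 1)%R).
Local Notation lambda := (@lebesgue_measure R).
Implicit Types t m a l : R.

(** The dual of the power weight, in the first coordinate; the value at 0 is forced by the
    convention of [weight_pow]. *)
Definition singular_power t : \bar R := if t == 0%R then +oo else (`|t| `^ (d - 1))%:E.

Lemma measurable_singular_power :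
  measurable_fun setT (singular_power : measurableTypeR R -> \bar R).
Proof.
apply: measurable_fun_ifT; [exact: measurable_fun_eqr|exact: measurable_cst|].
by apply/measurable_EFinP/measurable_fun_powRl; exact: normr_measurable.
Qed.

Lemma singular_power_ge0 t : 0 <= singular_power t.
Proof. by rewrite /singular_power; case: ifP => // _; rewrite lee_fin powR_ge0. Qed.

Lemma singular_powerN t : singular_power (- t) = singular_power t.
Proof. by rewrite /singular_power oppr_eq0 normrN. Qed.

Lemma integral_singular_pos m : (0 < m)%R ->
  \int[lambda]_(t in `[0%R, m]) singular_power t <= (m `^ d / d)%:E.
Proof.
move=> m0; apply: le_trans (integral_powR_le d0 m0).
rewrite -integral_itv_obnd_cbnd; last exact: measurable_funTS measurable_singular_power.
rewrite -[leRHS]integral_itv_obnd_cbnd; last first.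
  apply: measurable_funTS; apply/measurable_EFinP.
  exact: (measurable_powR (R := R) (d - 1)).
rewrite le_eqVlt; apply/orP; left; apply/eqP; apply: eq_integral => t.
rewrite inE /= in_itv /= => /andP[t0 _].
by rewrite /singular_power gt_eqF// gtr0_norm.
Qed.

Lemma integral_singular_neg m : (0 < m)%R ->
  \int[lambda]_(t in `[(- m)%R, 0%R]) singular_power t <= (m `^ d / d)%:E.
Proof.
move=> m0; apply: le_trans (integral_singular_pos m0).
have mN : measurable_fun setT (-%R : measurableTypeR R -> measurableTypeR R).
  exact: oppr_measurable.
have -> : \int[lambda]_(t in `[(- m)%R, 0%R]) singular_power t =
    \int[lambda]_(t in `[(- m)%R, 0%R]) singular_power (- t).
  by apply: eq_integral => t _; rewrite singular_powerN.
rewrite (@integral_comp_on _ _ (measurableTypeR R) (measurableTypeR R) R lambda lambda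
  (-%R) `[(- m)%R, 0%R]%classic `[0%R, m]%classic 1 mN); first by rewrite mul1e.
- exact: measurable_itv.
- exact: measurable_itv.
- by move=> t /=; rewrite !in_itv /= => /andP[h1 h2]; rewrite oppr_ge0 h2 lerNl.
- exact: ler01.
- move=> A mA AI; rewrite mul1e -[RHS](lebesgue_measureN mA) setIidl//.
  move=> t /= /AI /=; rewrite !in_itv /= => /andP[h1 h2].
  by rewrite -oppr_ge0 h1 lerNl h2.
- exact: measurable_singular_power.
- exact: singular_power_ge0.
Qed.

Lemma integral_singular_sym m : (0 < m)%R ->
  \int[lambda]_(t in `[(- m)%R, m]) singular_power t <= (2 * m `^ d / d)%:E.
Proof.
move=> m0; have mI : measurable (`]0%R, m] : set (measurableTypeR R)) by exact: measurable_itv.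
have mJ : measurable (`[(- m)%R, 0%R] : set (measurableTypeR R)) by exact: measurable_itv.
have -> : `[(- m)%R, m]%classic = `[(- m)%R, 0%R]%classic `|` `]0%R, m]%classic.
  apply/seteqP; split=> t /=; rewrite !in_itv /=.
    move=> /andP[h1 h2]; have [t0|t0] := leP t 0%R; [left|right].
      by rewrite h1.
    by [].
  by move=> [/andP[h1 h2]|/andP[h1 h2]]; apply/andP; split; lra.
rewrite (ge0_integral_setU _ mJ mI); last 3 first.
- exact: measurable_funTS measurable_singular_power.
- by move=> t _; exact: singular_power_ge0.
- apply/disj_setPS => t [] /=; rewrite !in_itv /= => /andP[_ h1] /andP[h2 _].
  by move: (lt_le_trans h2 h1); rewrite ltxx.
have -> : (2 * m `^ d / d = m `^ d / d + m `^ d / d)%R by field; rewrite gt_eqF.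
rewrite EFinD; apply: leeD; first exact: integral_singular_neg.
apply: le_trans (integral_singular_pos m0).
by rewrite integral_itv_obnd_cbnd//; exact: measurable_funTS measurable_singular_power.
Qed.

(** Far from the origin, [l <= m / 2], the integrand is at most [(m / 2)^(d-1) <= 2 m^(d-1)].
    Otherwise [m < 2 l], and enlarging the interval to [[-m, m]] is harmless. *)
Lemma integral_singular_itv a l : (0 < l)%R ->
  \int[lambda]_(t in `[a, (a + l)%R]) singular_power t <=
    (l * (4 / d) * (Num.max `|a| `|a + l|) `^ (d - 1))%:E.
Proof.
move=> l0; set m := Num.max _ _.
have a_m : (`|a| <= m)%R by rewrite le_max lexx.
have al_m : (`|a + l| <= m)%R by rewrite le_max lexx orbT.
have lm : (l <= 2 * m)%R.
  by have := ler_normB (a + l)%R a; rewrite addrAC subrr add0r gtr0_norm//; lra.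
have m0 : (0 < m)%R by lra.
have mI : measurable (`[a, (a + l)%R] : set (measurableTypeR R)) by exact: measurable_itv.
have sub : `[a, (a + l)%R]%classic `<=` `[(- m)%R, m]%classic.
  move=> t /=; rewrite !in_itv /= => /andP[h1 h2].
  by move: a_m al_m; rewrite !ler_norml => /andP[? ?] /andP[? ?]; apply/andP; split; lra.
have [far|near] := leP l (m / 2)%R; last first.
  apply: (@le_trans _ _ (2 * m `^ d / d)%:E).
    apply: le_trans (integral_singular_sym m0).
    apply: ge0_subset_integral; [exact: mI|exact: measurable_itv| | |exact: sub].
      exact: measurable_funTS measurable_singular_power.
    by move=> t _; exact: singular_power_ge0.
  rewrite lee_fin -(mulr_powRB1 (ltW m0) d0).
  have Y0 : (0 <= m `^ (d - 1))%R by exact: powR_ge0.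
  set Y := (m `^ (d - 1))%R in Y0 *.
  have -> : (2 * (m * Y) / d = d^-1 * Y * (2 * m))%R by ring.
  have -> : (l * (4 / d) * Y = d^-1 * Y * (4 * l))%R by ring.
  by apply: ler_wpM2l; [rewrite mulr_ge0// invr_ge0 ltW|lra].
have big t : (a <= t <= a + l)%R -> (m / 2 <= `|t|)%R.
  move=> /andP[h1 h2]; have [ma|ma] : m = `|a|%R \/ m = `|a + l|%R.
    by rewrite /m; case: leP; [right|left].
  - have := ler_normD t (a - t)%R; rewrite subrKC -ma.
    by rewrite [`|a - t|%R]distrC [`|t - a|%R]ger0_norm ?subr_ge0//; lra.
  - have := ler_normD t (a + l - t)%R; rewrite subrKC -ma.
    by rewrite [`|a + l - t|%R]ger0_norm ?subr_ge0//; lra.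
apply: (@le_trans _ _ (\int[lambda]_(t in `[a, (a + l)%R]) ((4 / d) * m `^ (d - 1))%:E)).
  apply: ge0_le_integral; [exact: mI| | | |].
  - by move=> t _; exact: singular_power_ge0.
  - exact: measurable_funTS measurable_singular_power.
  - exact: measurable_cst.
  - move=> t /=; rewrite in_itv /= => /big ht.
    have t0 : (0 < `|t|)%R by apply: lt_le_trans ht; rewrite divr_gt0.
    rewrite /singular_power -normr_eq0 gt_eqF// lee_fin.
    apply: (@le_trans _ _ ((m / 2) `^ (d - 1))%R).
      rewrite -opprB !powRN lef_pV2 ?posrE ?powR_gt0//; last by rewrite divr_gt0.
      by apply: ge0_ler_powR; rewrite ?nnegrE ?normr_ge0 ?subr_ge0 ?(ltW d1)// divr_ge0// ltW.
    rewrite powRM ?(ltW m0) ?invr_ge0// mulrC ler_wpM2r ?powR_ge0//.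
    rewrite -(powR_inv1 (ler0n R 2)) -powRrM mulN1r opprB.
    apply: (@le_trans _ _ 2%R).
      by rewrite -[leRHS]powRr1//; apply: ler_powR; [rewrite ler1n|rewrite gerBl ltW].
    by rewrite ler_pdivlMr//; move: d1; lra.
rewrite integral_cst//.
rewrite [X in _ * X](_ : _ = l%:E); last exact: lebesgue_measure_segment (ltW l0).
by rewrite -EFinM lee_fin mulrC mulrA.
Qed.

End singular_power.

(** * Power weights and test functions of the first coordinate *)

Section power_weight.
Local Open Scope ereal_scope.
Variables (R : realType) (n : nat).
Local Notation mu := (@lebesgue R n.+1).
Local Notation lambda := (@lebesgue_measure R).
Implicit Types (a : n.+1.-tuple R) (l : R).

Definition first (x : euclid R n.+1) : measurableTypeR R := tnth (x : n.+1.-tuple R) ord0.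

Lemma measurable_first : measurable_fun setT first.
Proof. exact: measurable_coord. Qed.

Lemma integral_first (h : measurableTypeR R -> \bar R) a l : (0 <= l)%R ->
  measurable_fun setT h -> (forall t, 0 <= h t) ->
  \int[mu]_(x in cube a l) h (first x) =
  (l ^+ n)%:E * \int[lambda]_(t in `[tnth a ord0, (tnth a ord0 + l)%R]) h t.
Proof.
move=> l0 mh h0.
pose I (i : 'I_n.+1) : set (measurableTypeR R) := [set` `[tnth a i, (tnth a i + l)%R]].
have mI i : measurable (I i) by exact: measurable_itv.
apply: (@integral_comp_on _ _ (euclid R n.+1) (measurableTypeR R) R mu lambda
  first (cube a l) (I ord0) (l ^+ n)%R).
- exact: measurable_first.
- exact: measurable_cube.
- exact: mI.
- by rewrite cubeE => x /(_ ord0).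
- exact: exprn_ge0.
- move=> A mA AI; pose B (i : 'I_n.+1) := if i == ord0 then A else I i.
  have mB i : measurable (B i) by rewrite /B; case: ifP.
  have -> : first @^-1` A `&` cube a l = [set t | forall i, B i (tnth t i)].
    rewrite cubeE; apply/seteqP; split=> [x [/= Ax xI] i|x xB].
      by rewrite /B; case: eqVneq => [->|_]; [exact: Ax|exact: xI].
    split; first by have := xB ord0; rewrite /B eqxx.
    move=> i; have := xB i; rewrite /B; case: eqVneq => [->|_] //.
    exact: AI.
  rewrite [LHS](lebesgue_box mB) big_ord_recl {1}/B eqxx muleC; congr (_ * _).
  rewrite (eq_bigr (fun=> l%:E)) => [|i _].
    by rewrite prodEFin big_const_ord iter_mulr_1.
  by rewrite /B lift_eqF; exact: lebesgue_measure_segment.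
- exact: mh.
- exact: h0.
Qed.

Lemma average_first (h : measurableTypeR R -> \bar R) a l : (0 < l)%R ->
  measurable_fun setT h -> (forall t, 0 <= h t) ->
  average (cube a l) (fun x => h (first x)) =
  (l^-1)%:E * \int[lambda]_(t in `[tnth a ord0, (tnth a ord0 + l)%R]) h t.
Proof.
move=> l0 mh h0; rewrite average_cube ?ltW// integral_first// ?ltW// muleA -EFinM.
congr (_%:E * _); rewrite exprSr invfM mulrC mulrA mulfV ?mul1r//.
by rewrite gt_eqF// exprn_gt0.
Qed.

Variables (p d : R).
Hypotheses (p1 : (1 < p)%R) (d0 : (0 < d)%R) (d1 : (d < 1)%R).

Let p1' : (0 < p - 1)%R. Proof. by rewrite subr_gt0. Qed.
Let d1' : (0 < 1 - d)%R. Proof. by rewrite subr_gt0. Qed.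

Let al := ((p - 1) * (1 - d))%R.
Let al0 : (0 < al)%R. Proof. exact: mulr_gt0. Qed.

Let pow (t : measurableTypeR R) : \bar R := (`|t| `^ al)%:E.

Definition power_weight (x : euclid R n.+1) : R := (`|first x| `^ al)%R.

Lemma weight_pow_power (t : R) :
  weight_pow (`|t| `^ al) (1 - conj_exp p) = singular_power d t.
Proof.
rewrite /weight_pow /singular_power one_sub_conj_exp// oppr_lt0 invr_gt0 p1' andbT.
rewrite powR_eq0 normr_eq0 (gt_eqF al0) andbT; case: eqVneq => // t0.
rewrite -powRrM; congr (_ `^ _)%:E; rewrite /al.
by field; rewrite gt_eqF.
Qed.

Let mpow : measurable_fun setT pow.
Proof. by apply/measurable_EFinP/measurable_fun_powRl; exact: normr_measurable. Qed.

Let pow0 t : 0 <= pow t. Proof. by rewrite lee_fin powR_ge0. Qed.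

Let int_pow (b l : R) : (0 < l)%R ->
  \int[lambda]_(t in `[b, (b + l)%R]) pow t <=
    (l * Num.max `|b| `|b + l| `^ al)%:E.
Proof.
move=> l0; set m := Num.max _ _.
have mI : measurable (`[b, (b + l)%R] : set (measurableTypeR R)) by exact: measurable_itv.
apply: (@le_trans _ _ (\int[lambda]_(t in `[b, (b + l)%R]) (m `^ al)%:E)).
  apply: ge0_le_integral; [exact: mI| | | |].
  - by move=> t _; exact: pow0.
  - exact: measurable_funTS.
  - exact: measurable_cst.
  - move=> t /=; rewrite in_itv /= => /andP[h1 h2]; rewrite lee_fin.
    have b_m : (`|b| <= m)%R by rewrite le_max lexx.
    have bl_m : (`|b + l| <= m)%R by rewrite le_max lexx orbT.
    have tm : (`|t| <= m)%R.
      move: b_m bl_m; rewrite !ler_norml => /andP[? ?] /andP[? ?].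
      by apply/andP; split; lra.
    apply: ge0_ler_powR; rewrite ?nnegrE ?(ltW al0)//.
    exact: le_trans tm.
rewrite integral_cst// [X in _ * X](_ : _ = l%:E).
  by rewrite -EFinM mulrC.
exact: lebesgue_measure_segment (ltW l0).
Qed.

Lemma power_weight_weight : weight power_weight.
Proof.
split; first by move=> x; exact: powR_ge0.
  apply: measurable_fun_powRl; apply: measurableT_comp measurable_first.
  exact: normr_measurable.
move=> _ [a [l [l0 ->]]]; rewrite (integral_first _ (ltW l0) mpow pow0).
apply: (@le_lt_trans _ _ ((l ^+ n)%:E * (l * Num.max `|tnth a ord0| `|tnth a ord0 + l| `^ al)%:E)).
  by apply: lee_wpmul2l; [rewrite lee_fin exprn_ge0// ltW|exact: int_pow].
by rewrite -EFinM ltry.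
Qed.

(** Both averages are controlled by the same [m], the largest [|x_0|] on the cube. The powers of [m]
    cancel since [al + (d-1)(p-1) = 0], and [4 / d] from the dual average remains, to the power
    [p - 1]. *)
Lemma power_weight_Ap_const : Ap_const p power_weight <= ((4 / d) `^ (p - 1))%:E.
Proof.
apply: ge_ereal_sup => _ [_ [a [l [l0 ->]]] <-].
have -> : (fun x => weight_pow (power_weight x) (1 - conj_exp p)) =
    (fun x => singular_power d (first x)).
  by apply/funext => x; exact: weight_pow_power.
rewrite (average_first a l0 mpow pow0).
rewrite (average_first a l0 (measurable_singular_power d) (singular_power_ge0 d)).
set b := tnth a ord0; set m := (Num.max `|b| `|b + l|)%R.
have m0 : (0 < m)%R.
  rewrite lt_max !normr_gt0; case: eqVneq => //= ->.
  by rewrite add0r gt_eqF.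
apply: (@le_trans _ _ ((m `^ al)%:E * ((4 / d * m `^ (d - 1)))%:E `^ (p - 1))).
  apply: lee_pmul.
  - by rewrite mule_ge0 ?integral_ge0// lee_fin invr_ge0 ltW.
  - exact: poweR_ge0.
  - apply: (@le_trans _ _ (l^-1%:E * (l * m `^ al)%:E)).
      by apply: lee_wpmul2l; [rewrite lee_fin invr_ge0 ltW|exact: int_pow].
    by rewrite -EFinM mulKf// gt_eqF.
  - have nn : 0 <= l^-1%:E * \int[lambda]_(t in `[b, (b + l)%R]) singular_power d t.
      rewrite mule_ge0 ?integral_ge0// ?lee_fin ?invr_ge0 ?ltW// => t _.
      exact: singular_power_ge0.
    have le : l^-1%:E * \int[lambda]_(t in `[b, (b + l)%R]) singular_power d t <=
        (4 / d * m `^ (d - 1))%:E.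
      apply: (@le_trans _ _ (l^-1%:E * (l * (4 / d) * m `^ (d - 1))%:E)).
        apply: lee_wpmul2l; first by rewrite lee_fin invr_ge0 ltW.
        exact: integral_singular_itv.
      by rewrite -EFinM -mulrA mulKf// gt_eqF.
    apply: gt0_ler_poweR; rewrite ?(ltW p1')// in_itv /= leey andbT//.
    exact: le_trans le.
rewrite poweR_EFin -EFinM lee_fin powRM ?powR_ge0//; last by rewrite divr_ge0// ltW.
rewrite -powRrM mulrCA -powRD; last by rewrite (gt_eqF m0) implybT.
rewrite (_ : (al + (d - 1) * (p - 1) = 0)%R); last by rewrite /al; ring.
by rewrite powRr0 mulr1.
Qed.

Lemma power_weight_Ap : Ap p power_weight.
Proof.
split; first exact: power_weight_weight.
by apply: le_lt_trans power_weight_Ap_const _; exact: ltry.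
Qed.

Let unit_cube : set (euclid R n.+1) := cube [tuple 0%R | i < n.+1] 1.

Definition power_fun (x : euclid R n.+1) : R := (\1_unit_cube x * first x `^ (d - 1))%R.

Let mfun : measurable_fun setT power_fun.
Proof.
apply: measurable_funM; first by apply: measurable_indic; exact: measurable_cube.
by apply: measurable_fun_powRl; exact: measurable_first.
Qed.

Let mEfun : measurable_fun setT (EFin \o power_fun).
Proof. exact/measurable_EFinP. Qed.

Let fun0 x : (0 <= power_fun x)%R.
Proof. by rewrite mulr_ge0// powR_ge0. Qed.

Let sing (t : measurableTypeR R) : \bar R := (t `^ (d - 1))%:E.

Let msing : measurable_fun setT sing.
Proof. by apply/measurable_EFinP; exact: measurable_fun_powRl. Qed.

Let sing0 t : 0 <= sing t. Proof. by rewrite lee_fin powR_ge0. Qed.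

Let unit_first x : unit_cube x -> (0 <= first x <= 1)%R.
Proof. by move=> /(_ ord0); rewrite tnth_mktuple add0r => -[-> ->]. Qed.

(** The exponents add up: [p (d-1) + al = d - 1]. At first coordinate 0 both integrands are 0, as
    [powR] vanishes at 0. *)
Lemma power_fun_norm :
  \int[mu]_x (`|(power_fun x)%:E| `^ p * (power_weight x)%:E) =
  \int[lambda]_(t in `[0%R, 1%R]) (t `^ (d - 1))%:E.
Proof.
have -> : \int[lambda]_(t in `[0%R, 1%R]) (t `^ (d - 1))%:E =
    \int[mu]_(x in unit_cube) sing (first x).
  by rewrite (integral_first _ ler01 msing sing0) expr1n mul1e tnth_mktuple add0r.
rewrite [RHS]integral_mkcond; apply: eq_integral => x _.
rewrite patchE /power_fun indicE; case: ifPn => [/set_mem xQ|xQ]; last first.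
  by rewrite mul0r abse0 poweR0r ?mul0e// gt_eqF// (lt_trans _ p1).
have /andP[t0 t1] := unit_first xQ.
rewrite mul1r /sing /power_weight /= (ger0_norm (powR_ge0 _ _)) (ger0_norm t0) -EFinM.
congr EFin; have [->|tn0] := eqVneq (first x) 0%R.
  have dn : (d - 1 != 0)%R by rewrite lt_eqF// subr_lt0.
  by rewrite (powR0 (lt0r_neq0 al0)) mulr0 (powR0 dn).
rewrite -powRrM -powRD; last by rewrite (negbTE tn0) implybT.
by congr (_ `^ _)%R; rewrite /al; ring.
Qed.

Lemma power_fun_wnorm : 0 < wnorm p power_weight (EFin \o power_fun) < +oo.
Proof.
rewrite /wnorm power_fun_norm; apply/andP; split.
  apply: poweR_gt0; apply: lt_le_trans (integral_powR_ge d0 ltr01).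
  by rewrite lte_fin powR1 divr_gt0// mulr_gt0.
apply: poweR_lty; apply: le_lt_trans (integral_powR_le d0 ltr01) _.
exact: ltry.
Qed.

(* For [x] in the unit cube, the average is taken over a subcube of the unit
   cube containing [x] whose side is the distance [first x] to the hyperplane
   where [power_fun] blows up. *)
Lemma maximal_power_fun (C : R) (g : euclid R n.+1 -> \bar R) : (0 <= C)%R ->
  measurable_fun setT g -> (forall x, (C * power_fun x)%:E <= g x) ->
  forall x, (C / (2 * d) * power_fun x)%:E <= maximal g x.
Proof.
move=> C0 mg hg x; have [xQ|xQ] := pselect (unit_cube x); last first.
  by rewrite /power_fun indicE memNset// mul0r mulr0; exact: maximal_ge0.
have /andP[t0 t1] := unit_first xQ.
set t : R := first x in t0 t1 *.
(* On the hyperplane [power_fun] is 0, by the value of [powR] at 0, and the claim is trivial. *)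
have [tE|tn0] := eqVneq t 0%R.
  rewrite /power_fun -/t tE powR0 ?mulr0; first exact: maximal_ge0.
  by rewrite lt_eqF// subr_lt0.
have {t0 tn0}t0 : (0 < t)%R by rewrite lt0r tn0.
(* In the other coordinates the side starts at [x_i], unless it would leave the unit cube, in which
   case it is moved back to end at 1. *)
pose a : n.+1.-tuple R :=
  [tuple (if i == ord0 then 0 else Num.min (tnth (x : n.+1.-tuple R) i) (1 - t))%R | i < n.+1].
have a0 : tnth a ord0 = 0%R by rewrite tnth_mktuple eqxx.
have xa : cube a t x.
  move=> i; rewrite tnth_mktuple; case: eqVneq => [->|_].
    by rewrite add0r; split; [exact: ltW|exact: lexx].
  have := xQ i; rewrite tnth_mktuple add0r => -[h1 h2].
  by rewrite addr_minl ge_min le_min lexx lerDl (ltW t0) subrK.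
have sub : cube a t `<=` unit_cube.
  apply: cube_sub => i; rewrite !tnth_mktuple; case: eqVneq => [_|_].
  - exact: lexx.
  - by have [h1 _] := xQ i; rewrite tnth_mktuple in h1; rewrite le_min h1 subr_ge0.
  - by rewrite !add0r.
  - by rewrite add0r addr_minl ge_min subrK lexx orbT.
apply: (@le_trans _ _ (average (cube a t) (fun y => `|g y|))); last first.
  by apply: ereal_sup_ubound; exists (cube a t) => //; split => //; exists a, t.
apply: (@le_trans _ _ (average (cube a t) (fun y => C%:E * sing (first y)))); last first.
  rewrite !average_cube ?(ltW t0)//; apply: lee_wpmul2l.
    by rewrite lee_fin invr_ge0 exprn_ge0// ltW.
  apply: ge0_le_integral; [exact: measurable_cube| | | |].
  - by move=> y _; rewrite mule_ge0// lee_fin.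
  - apply: measurable_funTS; apply: measurable_funeM.
    by apply/measurable_EFinP/measurable_fun_powRl; exact: measurable_first.
  - exact: measurable_fun_abse.
  - move=> y yQ; apply: le_trans (lee_abs _); apply: le_trans (hg y).
    by rewrite /power_fun indicE (mem_set (sub _ yQ)) mul1r /sing -EFinM.
have mCs : measurable_fun setT (fun s => C%:E * sing s) by exact: measurable_funeM.
have Cs0 s : 0 <= C%:E * sing s by rewrite mule_ge0// lee_fin.
rewrite (average_first a t0 mCs Cs0) a0 add0r.
rewrite [X in _ <= _ * X](_ : _ = C%:E * \int[lambda]_(s in `[0%R, t]) sing s); last first.
  apply: ge0_integralZl_EFin; [exact: measurable_itv| | |exact: C0].
    by move=> s _; exact: sing0.
  exact: measurable_funTS msing.
rewrite /power_fun indicE mem_set// mul1r -/t.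
apply: (@le_trans _ _ (t^-1%:E * (C%:E * (t `^ d / (2 * d))%:E))).
  rewrite -!EFinM lee_fin -(mulr_powRB1 (ltW t0) d0).
  rewrite le_eqVlt; apply/orP; left; apply/eqP.
  by field; rewrite !gt_eqF.
apply: lee_wpmul2l; first by rewrite lee_fin invr_ge0 ltW.
by apply: lee_wpmul2l; [rewrite lee_fin|exact: integral_powR_ge].
Qed.

Lemma iter_maximal_power_fun k :
  measurable_fun setT (iter k (@maximal R n.+1) (EFin \o power_fun)) /\
  forall x, ((2 * d)^-1 ^+ k * power_fun x)%:E <=
    iter k (@maximal R n.+1) (EFin \o power_fun) x.
Proof.
elim: k => [|k [mk hk]].
  by split; [exact: mEfun|move=> x; rewrite expr0 mul1r].
split; first exact: measurable_maximal mk.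
move=> x; rewrite exprSr; apply: (maximal_power_fun _ mk hk).
by rewrite exprn_ge0// invr_ge0 mulr_ge0// ltW.
Qed.

(** Any admissible constant is tested on [power_fun], whose norm is positive and finite and so
    cancels. *)
Lemma opnorm_power_weight k :
  ((2 * d)^-1 ^+ k)%:E <= opnorm p power_weight (iter k (@maximal R n.+1)).
Proof.
apply: le_ereal_inf_tmp => _ [C [C0 hC] <-].
have /andP[f_gt0 f_fin] := power_fun_wnorm.
have fLp : in_Lp p power_weight (EFin \o power_fun).
  by split; [exact: mEfun|exact: f_fin].
have [mk hk] := iter_maximal_power_fun k.
have := hC _ fLp.
set c := ((2 * d)^-1 ^+ k)%R.
have c0 : (0 <= c)%R by rewrite exprn_ge0// invr_ge0 mulr_ge0// ltW.
have pV0 : (0 <= p^-1)%R by rewrite invr_ge0 ltW// (lt_trans _ p1).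
have p0 : (0 <= p)%R by rewrite ltW// (lt_trans _ p1).
have [w0 mw _] := power_weight_weight.
have le : c%:E * wnorm p power_weight (EFin \o power_fun) <=
    wnorm p power_weight (iter k (@maximal R n.+1) (EFin \o power_fun)).
  rewrite /wnorm.
  have -> : c%:E = (c `^ p)%:E `^ p^-1.
    rewrite poweR_EFin -powRrM mulfV ?powRr1// gt_eqF//.
    exact: lt_trans p1.
  have I0 g : 0 <= \int[mu]_x (`|g x| `^ p * (power_weight x)%:E).
    by apply: integral_ge0 => x _; exact: wnorm_integrand_ge0.
  rewrite -poweRM ?lee_fin ?powR_ge0//.
  have mI := measurable_wnorm_integrand p mw mEfun.
  have J0 x : setT x -> 0 <= `|(EFin \o power_fun) x| `^ p * (power_weight x)%:E.
    by move=> _; exact: wnorm_integrand_ge0.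
  rewrite -(ge0_integralZl_EFin mu measurableT J0 mI (powR_ge0 c p)).
  have leI : \int[mu]_x ((c `^ p)%:E * (`|(EFin \o power_fun) x| `^ p * (power_weight x)%:E)) <=
     \int[mu]_x (`|iter k (@maximal R n.+1) (EFin \o power_fun) x| `^ p * (power_weight x)%:E).
    apply: ge0_le_integral; [exact: measurableT| | | |].
    - by move=> x _; apply: mule_ge0; [rewrite lee_fin powR_ge0|exact: wnorm_integrand_ge0].
    - exact: measurable_funeM mI.
    - exact: measurable_wnorm_integrand mw mk.
    - move=> x _; rewrite muleA; apply: lee_wpmul2r; first by rewrite lee_fin.
      rewrite -poweR_EFin -poweRM ?lee_fin//; apply: gt0_ler_poweR => //.
      + by rewrite in_itv /= leey andbT mule_ge0// lee_fin.
      + by rewrite in_itv /= leey andbT.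
      + rewrite [X in _ * X]gee0_abs ?lee_fin// -EFinM.
        exact: le_trans (hk x) (lee_abs _).
  apply: gt0_ler_poweR => //; rewrite in_itv /= leey andbT.
  - rewrite (ge0_integralZl_EFin mu measurableT J0 mI (powR_ge0 c p)).
    by apply: mule_ge0; [rewrite lee_fin powR_ge0|exact: I0].
  - exact: I0.
move=> /(le_trans le); rewrite lee_pmul2r// ge0_fin_numE//; exact: ltW.
Qed.

End power_weight.

(** Write [y^k = y^(k-e) y^e]; the lower bound on [y] gives [y^(k-e) >= C + 1 > C]. *)
Lemma powR_lt_exprn (R : realType) (k : nat) (C e y : R) : 0 <= C -> 0 < y ->
  0 < k%:R - e -> (C + 1) `^ (k%:R - e)^-1 <= y -> C * y `^ e < y ^+ k.
Proof.
move=> C0 y0 ek yC; have C1 : 0 < C + 1 by rewrite ltr_wpDl.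
rewrite -(powR_mulrn k (ltW y0)) -[in ltRHS](subrK e k%:R).
rewrite powRD; last by rewrite (gt_eqF y0) implybT.
rewrite ltr_pM2r ?powR_gt0//.
apply: (@lt_le_trans _ _ (C + 1)); first by rewrite ltrDl.
have : ((C + 1) `^ (k%:R - e)^-1) `^ (k%:R - e) <= y `^ (k%:R - e).
  by apply: ge0_ler_powR; rewrite ?nnegrE ?powR_ge0 ?(ltW y0) ?(ltW ek).
by rewrite -powRrM mulVf ?gt_eqF// powRr1 ?(ltW C1).
Qed.

Lemma Ap_exponent_sharp (R : realType) (n k : nat) (p s : R) : (0 < k)%N -> 1 < p ->
  s < k%:R / (p - 1) ->
  ~ exists c : R, forall w : euclid R n.+1 -> R, Ap p w ->
      (opnorm p w (iter k (@maximal R n.+1)) <= c%:E * Ap_const p w `^ s)%E.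
Proof.
move=> k0 p1 hs [c hc].
have p1' : 0 < p - 1 by rewrite subr_gt0.
set r := k%:R / (p - 1) in hs.
have r0 : 0 < r by rewrite divr_gt0// ltr0n.
(* [s] may be negative. It is raised to a nonnegative exponent still below [r], which is allowed
   once [1 <= A]. *)
pose s' := Num.max s 0; have s'0 : 0 <= s' by rewrite le_max lexx orbT.
have ss' : s <= s' by rewrite le_max lexx.
have s'r : s' < r by rewrite gt_max hs r0.
pose e := (p - 1) * s'.
have ek : 0 < k%:R - e by rewrite subr_gt0 /e mulrC -ltr_pdivlMr.
pose K : R := maximal_cst n.+1 p + 1.
have K0 : 0 <= maximal_cst n.+1 p by exact: powR_ge0.
have K1 : 0 < K by rewrite ltr_wpDl.
pose B := `|c| * 4 `^ e * 2 ^+ k + 1.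
have B0 : 0 <= `|c| * 4 `^ e * 2 ^+ k by rewrite !mulr_ge0 ?powR_ge0// exprn_ge0.
have B1 : 0 < B by rewrite ltr_wpDl.
have b0 : 0 < B `^ (k%:R - e)^-1 by exact: powR_gt0.
(* [y] is [1 / d]. The three summands serve in turn for [d < 1], for [1 <= A], and for the final
   comparison of [y^k] with [y^e]. *)
pose y := 2 + 2 * K + B `^ (k%:R - e)^-1.
have y1 : 1 < y by rewrite /y; lra.
have yK : 2 * K <= y by rewrite /y; lra.
have yB : B `^ (k%:R - e)^-1 <= y by rewrite /y; lra.
have y0 : 0 < y by lra.
have d0 : 0 < y^-1 by rewrite invr_gt0.
have d1 : y^-1 < 1 by rewrite invf_lt1.
have Apw := power_weight_Ap n p1 d0 d1.
have upper := power_weight_Ap_const n p1 d0 d1.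
have lower := opnorm_power_weight n p1 d0 d1 k.
have AE := Ap_constE Apw; have A0 := Ap_const_ge0 Apw.
set w := power_weight _ _ in Apw upper lower AE A0.
rewrite AE in upper A0; set A := fine _ in upper A0 AE.
rewrite lee_fin in upper; rewrite lee_fin in A0.
have yE : (2 * y^-1)^-1 = y / 2 by rewrite invfM invrK mulrC.
(* If [A < 1], the upper bound already proved would put the norm below [K^k], whereas it is at least
   [(y / 2)^k >= K^k]. *)
have A1 : 1 <= A.
  rewrite leNgt; apply/negP => A1.
  have := le_trans lower (opnorm_iter_maximal_le k p1 Apw).
  rewrite AE poweR_EFin -EFinM lee_fin yE leNgt => /negP; apply.
  have Ar : A `^ r < 1.
    have : A `^ r < 1 `^ r by apply: gt0_ltr_powR; rewrite ?nnegrE.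
    by rewrite powR1.
  apply: (@le_lt_trans _ _ (K ^+ k * A `^ r)).
    apply: ler_wpM2r; first exact: powR_ge0.
    by apply: lerXn2r; rewrite ?nnegrE ?(ltW K1)// lerDl.
  apply: (@lt_le_trans _ _ (K ^+ k)); first by rewrite gtr_pMr// exprn_gt0.
  apply: lerXn2r; rewrite ?nnegrE ?(ltW K1)//; first by rewrite divr_ge0// ltW.
  by rewrite ler_pdivlMr// mulrC.
have := le_trans lower (hc w Apw); rewrite AE poweR_EFin -EFinM lee_fin yE leNgt => /negP; apply.
(* From [A <= (4 y)^(p-1)] follows [A^s' <= (4 y)^e], where [e = (p-1) s' < k]. *)
apply: (@le_lt_trans _ _ (`|c| * 4 `^ e * y `^ e)).
  rewrite -mulrA -powRM ?(ltW y0)//.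
  apply: (@le_trans _ _ (`|c| * A `^ s)); first by rewrite ler_wpM2r ?powR_ge0// ler_norm.
  apply: ler_wpM2l => //; apply: (@le_trans _ _ (A `^ s')); first exact: ler_powR.
  rewrite /e powRrM; apply: ge0_ler_powR; rewrite ?nnegrE ?powR_ge0//.
  by rewrite invrK in upper.
rewrite expr_div_n ltr_pdivlMr; last exact: exprn_gt0.
by rewrite mulrAC; exact: powR_lt_exprn.
Qed.

Theorem corollary4p1 (R : realType) (n k : nat) (p : R)
    (hn : (0 < n)%N) (hk : (0 < k)%N) (hp : 1 < p) :
  (exists c : R, forall w : euclid R n -> R, Ap p w ->
     (opnorm p w (iter k (@maximal R n)) <=
        c%:E * Ap_const p w `^ (k%:R / (p - 1)))%E) /\
  (forall s : R, s < k%:R / (p - 1) ->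
     ~ exists c : R, forall w : euclid R n -> R, Ap p w ->
         (opnorm p w (iter k (@maximal R n)) <=
            c%:E * Ap_const p w `^ s)%E).
Proof.
split.
  by exists (maximal_cst n p ^+ k) => w Apw; exact: opnorm_iter_maximal_le.
case: n hn => // n _ s hs.
exact: Ap_exponent_sharp hk hp hs.
Qed.
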